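(* There is a randomised polynomial-time algorithm, based on the system of linear equations $Av = 0$ over the rational numbers (where $A$ is the incidence matrix of the input hypergraph), which, given as input a 3-uniform hypergraph $H$ with $n \geq 8$ vertices that admits an LO 2-colouring, finds, with probability at least $\frac{1}{4}$, an LO colouring of $H$ with at most $1.5 \log_2 n + O(\log\log n)$ colours.
   Context: A hypergraph $H$ consists of a finite vertex set and a finite set of edges, each edge being a set of vertices; $H$ is 3-uniform if every edge consists of exactly 3 vertices. A linearly ordered (LO) $k$-colouring of $H$ is an assignment to each vertex of a colour from $\{0,1,\ldots,k-1\}$ such that every edge has a unique maximum colour, i.e. the maximum colour appearing in the edge is attained by exactly one vertex of the edge. The incidence matrix $A$ of $H$ has one row per edge and one column per vertex, with entry $1$ if the vertex belongs to the edge and $0$ otherwise; so $Av=0$ says that $v_x+v_y+v_z=0$ for every edge $\{x,y,z\}$. The algorithm is given only $H$, with the promise that an LO 2-colouring of $H$ exists; the probability is over the internal randomness of the algorithm, and the constant in $O(\log\log n)$ is absolute. *)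

(* Defs.v *)
From mathcomp Require Import all_boot all_order all_algebra.
From mathcomp Require Import all_classical all_reals all_analysis.

Set Implicit Arguments.
Unset Strict Implicit.
Unset Printing Implicit Defensive.

Import Order.TTheory GRing.Theory Num.Theory.

Local Open Scope ring_scope.

Definition hypergraph (T : finType) := {set {set T}}.

Definition uniform3 (T : finType) (H : hypergraph T) : Prop :=
  forall e, e \in H -> #|e| = 3%N.

Definition LO_colouring (T : finType) (H : hypergraph T) (k : nat)
    (c : T -> 'I_k) : Prop :=
  forall e, e \in H ->
    #|[set x in e | nat_of_ord (c x) == \max_(y in e) nat_of_ord (c y)]| = 1%N.

Definition incidence (n : nat) (H : hypergraph 'I_n) : 'M[rat]_(#|H|, n) :=
  \matrix_(i < #|H|, j < n) (j \in (enum_val i : {set 'I_n}))%:R.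

Definition log2 (R : realType) (x : R) : R := ln x / ln 2.

(** A probabilistic random access machine.

    The machine is presented as a small structured language.  Its memory is an
    infinite array of rational numbers with indirect addressing, and its time
    is measured under the logarithmic cost criterion: every operation is
    charged the bit length of the numbers it handles.  A time bound therefore
    bounds the sizes of all intermediate numbers as well, and polynomial time
    on this machine is polynomial time on Turing machines. *)

Inductive expr :=
| Cst of nat
| Read of expr
| EAdd of expr & expr
| ESub of expr & expr
| EMul of expr & expr
| EDiv of expr & expr
| Floor of expr
| Leq of expr & expr.

Inductive cmd :=
| Skip
| Write of expr & expr
| Flip of expr
| Seq of cmd & cmd
| If of expr & cmd & cmd
| While of expr & cmd.

Definition mem := nat -> rat.

(** The address denoted by [q] is [Num.truncn q], which is 0 if [q < 0]. *)
Definition upd (m : mem) (a q : rat) : mem :=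
  fun i => if i == Num.truncn a then q else m i.

(** Division by zero yields 0, as in [rat]; [Leq] yields 1 or 0. *)
Fixpoint eval (m : mem) (e : expr) : rat :=
  match e with
  | Cst k => k%:R
  | Read e1 => m (Num.truncn (eval m e1))
  | EAdd e1 e2 => eval m e1 + eval m e2
  | ESub e1 e2 => eval m e1 - eval m e2
  | EMul e1 e2 => eval m e1 * eval m e2
  | EDiv e1 e2 => eval m e1 / eval m e2
  | Floor e1 => (Num.floor (eval m e1))%:~R
  | Leq e1 e2 => (eval m e1 <= eval m e2)%R%:R
  end.

Definition bitlen (k : nat) : nat := (trunc_log 2 k).+1.

Definition ratlen (q : rat) : nat := (bitlen `|numq q| + bitlen `|denq q|)%N.

(** Every value produced in the evaluation of [e] is charged its length. *)
Fixpoint ecost (m : mem) (e : expr) : nat :=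
  (ratlen (eval m e) +
   match e with
   | Cst _ => 0
   | Read e1 | Floor e1 => ecost m e1
   | EAdd e1 e2 | ESub e1 e2 | EMul e1 e2 | EDiv e1 e2 | Leq e1 e2 =>
       ecost m e1 + ecost m e2
   end)%N.

(** [exec c m r t m' r']: started in memory [m] with coin tape [r], the program
    [c] halts in time [t] in memory [m'], with [r'] the unused part of the
    tape.  There is no rule for [Flip] on an empty tape. *)
Inductive exec : cmd -> mem -> seq bool -> nat -> mem -> seq bool -> Prop :=
| exec_skip m r :
    exec Skip m r 1 m r
| exec_write a e m r :
    exec (Write a e) m r (1 + ecost m a + ecost m e)%N
         (upd m (eval m a) (eval m e)) r
| exec_flip a m b r :
    exec (Flip a) m (b :: r) (1 + ecost m a)%N (upd m (eval m a) b%:R) r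
| exec_seq c1 c2 m r t1 m1 r1 t2 m2 r2 :
    exec c1 m r t1 m1 r1 -> exec c2 m1 r1 t2 m2 r2 ->
    exec (Seq c1 c2) m r (1 + t1 + t2)%N m2 r2
| exec_if e c1 c2 m r t m1 r1 :
    exec (if eval m e != 0 then c1 else c2) m r t m1 r1 ->
    exec (If e c1 c2) m r (1 + ecost m e + t)%N m1 r1
| exec_while_end e c m r :
    eval m e = 0 ->
    exec (While e c) m r (1 + ecost m e)%N m r
| exec_while_step e c m r t1 m1 r1 t2 m2 r2 :
    eval m e != 0 ->
    exec c m r t1 m1 r1 -> exec (While e c) m1 r1 t2 m2 r2 ->
    exec (While e c) m r (1 + ecost m e + t1 + t2)%N m2 r2.

(** Runs are deterministic in the memory and the coin tape. *)
Lemma exec_det c m r t1 m1 r1 t2 m2 r2 :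
  exec c m r t1 m1 r1 -> exec c m r t2 m2 r2 ->
  [/\ t1 = t2, m1 = m2 & r1 = r2].
Proof.
move=> h; elim: h t2 m2 r2 => {c m r t1 m1 r1}.
- by move=> m r t2 m2 r2 h; inversion h.
- by move=> a e m r t2 m2 r2 h; inversion h.
- by move=> a m b r t2 m2 r2 h; inversion h.
- move=> c1 c2 m r t1 m1 r1 t2 m2 r2 _ ih1 _ ih2 t' m' r' h.
  inversion h; subst.
  match goal with h1 : exec c1 _ _ _ _ _ |- _ =>
    case: (ih1 _ _ _ h1) => *; subst end.
  by match goal with h2 : exec c2 _ _ _ _ _ |- _ =>
    case: (ih2 _ _ _ h2) => *; subst end.
- move=> e c1 c2 m r t m1 r1 _ ih t' m' r' h.
  inversion h; subst.
  by match goal with h1 : exec (if _ then _ else _) _ _ _ _ _ |- _ =>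
    case: (ih _ _ _ h1) => *; subst end.
- move=> e c m r e0 t' m' r' h; inversion h; subst => //.
  by match goal with h1 : is_true (eval _ _ != 0) |- _ =>
    rewrite e0 eqxx in h1 end.
- move=> e c m r t1 m1 r1 t2 m2 r2 e0 _ ih1 _ ih2 t' m' r' h.
  inversion h; subst.
    by match goal with h1 : eval _ _ = 0 |- _ => rewrite h1 eqxx in e0 end.
  match goal with h1 : exec c _ _ _ _ _ |- _ =>
    case: (ih1 _ _ _ h1) => *; subst end.
  by match goal with h2 : exec (While _ _) _ _ _ _ _ |- _ =>
    case: (ih2 _ _ _ h2) => *; subst end.
Qed.

Definition input (s : seq rat) : mem := fun i => s`_i.

(** A 3-uniform hypergraph is written as its number of vertices and of edges,
    followed by the three vertices of every edge. *)
Definition hypergraph_code (n : nat) (H : hypergraph 'I_n) : seq rat :=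
  n%:R :: #|H|%:R ::
  flatten [seq [seq (nat_of_ord x)%:R | x <- enum (e : {set 'I_n})]
          | e <- enum H].

Definition vector_code (n : nat) (v : 'cV[rat]_n) : seq rat :=
  n%:R :: [seq v i 0 | i <- enum 'I_n].

(** Cell [i + 1] holds the entry of the output for the vertex [i]. *)
Definition output (n : nat) (m : mem) : 'cV[rat]_n := \col_i m i.+1.

(** An algorithm based on a vector of rationals: [solve] is run on the
    hypergraph and leaves a vector [v], then [rounding] is run in a fresh
    memory that contains only [v], with the coins left over by [solve], and
    leaves the vector [w].  The time of the whole run is [t]. *)
Definition run (solve rounding : cmd) (n : nat) (H : hypergraph 'I_n)
    (r : seq bool) (t : nat) (v w : 'cV[rat]_n) : Prop :=
  exists t1 m1 r1 t2 m2 r2,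
    [/\ exec solve (input (hypergraph_code H)) r t1 m1 r1,
        v = output n m1,
        exec rounding (input (vector_code v)) r1 t2 m2 r2,
        w = output n m2
      & t = (t1 + t2)%N].

(** Probability of [P] for [N] independent fair coins. *)
Definition Pr (N : nat) (P : N.-tuple bool -> Prop) : rat :=
  #|[set r : N.-tuple bool | `[< P r >]]|%:R / (2 ^ N)%:R.

(* Main.v *)
Require Import Defs.
From mathcomp Require Import all_boot all_order all_algebra all_fingroup.
From mathcomp Require Import all_classical all_reals all_analysis.
From mathcomp Require Import ring lra zify.
Import Defs.

(** The colour of a vertex is the exponent of 2 in its entry of an integral
    solution [v] of the system.  If v_x + v_y + v_z = 0, divide the three
    numbers by the largest power of 2 that divides all of them: some quotient
    is odd and their sum is even, so exactly two are odd, and the third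
    vertex has the unique maximal exponent in the edge ([three_odd], [LO_val]).
    This is an LO colouring as soon as no entry of [v] vanishes, and it uses
    few colours if no entry is divisible by a high power of 2.

    Such a [v] is a random combination, with coefficients of [n] bits, of the
    columns of a matrix [C] that describes all solutions.  [C] comes from
    fraction-free Gaussian elimination, in which the pivot is an entry with the
    fewest factors 2, and these factors are divided out ([reduced_pivot]).
    Thus [C] is integral, and every solution [u] satisfies [C u = E u] for
    an odd integer [E].  An LO 2-colouring provides the solution with the
    entries 2 and -1, which shows that no row of [C] is divisible by 4
    ([LO2_row]).  For a fixed vertex, each further factor 2 then halves the
    probability that it divides the entry of [v], because flipping one suitable
    coin destroys this factor and no lower one ([halving]).  A union bound over
    the vertices ([union_tail]) leaves probability at least 1/2 that no entry
    is divisible by 2 ^ (trunc_log 2 n + 3); this exponent is the number of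
    colours.

    The numbers stay short because the columns of [C] are, up to a power of 2,
    columns of the adjugate of a matrix with entries 0 and 1 ([witness_adj]),
    hence bounded by n! by the Leibniz formula.  The programs are verified in a
    Hoare logic that maintains a bound [L] on the bit lengths of
    all memory cells and on the number of rounds of every loop; the running
    time is then a polynomial in [L] that can be read off the program
    ([cost_bound], [hoare_for]). *)

Set Implicit Arguments.
Unset Strict Implicit.
Unset Printing Implicit Defensive.

Import Order.TTheory GRing.Theory Num.Theory.

Local Open Scope ring_scope.

(** * Sizes of rational numbers *)

Definition bnd (L : nat) (q : rat) : bool :=
  (`|numq q| <= 2 ^ L)%N && (`|denq q| <= 2 ^ L)%N.

Lemma leq_pow2 a b : (a <= b)%N -> (2 ^ a <= 2 ^ b)%N.
Proof. by move=> h; rewrite leq_exp2l. Qed.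

Lemma bndW L L' q : (L <= L')%N -> bnd L q -> bnd L' q.
Proof.
move=> h /andP[h1 h2]; apply/andP; split; apply: leq_trans (leq_pow2 h) => //.
Qed.

(** Reducing a fraction does not lengthen it. *)
Lemma bnd_frac L (a b : int) : b != 0 ->
  (`|a| <= 2 ^ L)%N -> (`|b| <= 2 ^ L)%N -> bnd L (a%:~R / b%:~R).
Proof.
move=> b0 ha hb; rewrite /bnd.
case: (@divqP a b) ha hb => [|k x k0]; first by move/eqP: b0.
rewrite !abszM => ha hb.
have k1 : (0 < `|k|)%N by rewrite absz_gt0.
by rewrite (leq_trans (leq_pmull _ k1) ha) (leq_trans (leq_pmull _ k1) hb).
Qed.

Lemma bnd_natr L k : (k <= 2 ^ L)%N -> bnd L k%:R.
Proof.
move=> h; have -> : k%:R = (k%:Z)%:~R / 1%:~R :> rat by rewrite divr1.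
by apply: bnd_frac => //; rewrite absz1 expn_gt0.
Qed.

Lemma bnd0 L : bnd L 0.
Proof. exact: (@bnd_natr L 0). Qed.

Lemma bnd1 L : bnd L 1.
Proof. by apply: (@bnd_natr L 1); rewrite expn_gt0. Qed.

Lemma bndD L1 L2 x y : bnd L1 x -> bnd L2 y -> bnd (L1 + L2).+1 (x + y).
Proof.
move=> /andP[a b] /andP[c d].
have -> : x + y = (numq x * denq y + numq y * denq x)%:~R / (denq x * denq y)%:~R.
  rewrite -{1}(divq_num_den x) -{1}(divq_num_den y) addf_div ?intr_eq0 //.
  by rewrite !(intrD, intrM).
apply: bnd_frac; first by rewrite mulf_neq0.
- rewrite expnS mul2n -addnn expnD.
  have tri (u v : int) : (`|(u + v)%R| <= `|u| + `|v|)%N by lia.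
  apply: leq_trans (tri _ _) _; rewrite !abszM; apply: leq_add; first exact: leq_mul.
  by rewrite mulnC; apply: leq_mul.
- rewrite abszM expnS expnD.
  by apply: leq_trans (leq_pmull _ _) => //; apply: leq_mul.
Qed.

Lemma bndN L x : bnd L x -> bnd L (- x).
Proof. by rewrite /bnd numqN denqN abszN. Qed.

Lemma bndM L1 L2 x y : bnd L1 x -> bnd L2 y -> bnd (L1 + L2) (x * y).
Proof.
move=> /andP[a b] /andP[c d].
have -> : x * y = (numq x * numq y)%:~R / (denq x * denq y)%:~R.
  by rewrite -{1}(divq_num_den x) -{1}(divq_num_den y) mulf_div !intrM.
by apply: bnd_frac; rewrite ?mulf_neq0 // abszM expnD leq_mul.
Qed.

Lemma bndV L x : bnd L x -> bnd L x^-1.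
Proof.
case: (eqVneq x 0) => [->|x0]; first by rewrite invr0.
move=> /andP[a b].
have -> : x^-1 = (denq x)%:~R / (numq x)%:~R.
  by rewrite -{1}(divq_num_den x) invf_div.
by apply: bnd_frac; rewrite ?numq_eq0.
Qed.

Lemma bnd_floor L x : bnd L x -> bnd L.+1 (Num.floor x)%:~R.
Proof.
move=> /andP[a b].
have -> : (Num.floor x)%:~R = (Num.floor x)%:~R / 1%:~R :> rat by rewrite divr1.
apply: bnd_frac => //; last by rewrite absz1 expn_gt0.
have h : (`|Num.floor x| <= `|numq x| + 1)%N.
  rewrite floorErat; move: (denq_gt0 x) => d0.
  have := divz_eq (numq x) (denq x).
  have := modz_ge0 (numq x) (lt0r_neq0 d0); have := ltz_pmod (numq x) d0.
  move: (numq x) (denq x) d0 (_ %/ _)%Z (_ %% _)%Z => u v v0 k r r1 r0 e; nia.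
rewrite expnS mul2n -addnn; apply: leq_trans h _; apply: leq_add => //.
by rewrite expn_gt0.
Qed.

Lemma ratlen_bnd L x : bnd L x -> (ratlen x <= 2 * L.+1)%N.
Proof.
have bl k : (k <= 2 ^ L)%N -> (bitlen k <= L.+1)%N.
  rewrite /bitlen ltnS => h.
  by rewrite -[leqRHS](@trunc_expnK 2) // leq_trunc_log.
by move=> /andP[/bl a /bl b]; rewrite /ratlen mul2n -addnn leq_add.
Qed.

Lemma leq_expn2 k : (k <= 2 ^ k)%N.
Proof. by rewrite ltnW // ltn_expl. Qed.

Definition mbnd L (m : mem) := forall i, bnd L (m i).

(** Bit lengths add up under the arithmetic operations: over cells of at most
    [L] bits, the value of [e] has at most [width e * L] bits. *)
Fixpoint width (e : expr) : nat :=
  match e with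
  | Cst k => k.+1
  | Read _ | Leq _ _ => 1
  | EAdd e1 e2 | ESub e1 e2 => (width e1 + width e2).+1
  | EMul e1 e2 | EDiv e1 e2 => width e1 + width e2
  | Floor e1 => (width e1).+1
  end.

Fixpoint ecost_bound (e : expr) : nat :=
  (4 * width e +
   match e with
   | Cst _ => 0
   | Read e1 | Floor e1 => ecost_bound e1
   | EAdd e1 e2 | ESub e1 e2 | EMul e1 e2 | EDiv e1 e2 | Leq e1 e2 =>
       ecost_bound e1 + ecost_bound e2
   end)%N.

Lemma width_gt0 e : (0 < width e)%N.
Proof. by elim: e => //= e1 h1 e2 h2; rewrite addn_gt0 h1. Qed.

Section Size.

Variables (L : nat) (m : mem).
Hypotheses (L0 : (0 < L)%N) (mL : mbnd L m).

Lemma eval_bnd e : bnd (width e * L) (eval m e).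
Proof.
have two e1 e2 : ((width e1 * L + width e2 * L).+1 <= (width e1 + width e2).+1 * L)%N.
  by rewrite -mulnDl mulSn -addn1 addnC leq_add2r.
elim: e => [k|e _|e1 h1 e2 h2|e1 h1 e2 h2|e1 h1 e2 h2|e1 h1 e2 h2|e h|e1 _ e2 _] /=.
- apply: bnd_natr; apply: leq_trans (leq_expn2 k) _.
  by apply: leq_pow2; apply: leq_trans (leqnSn k) _; rewrite leq_pmulr.
- by rewrite mul1n.
- exact: bndW (two _ _) (bndD h1 h2).
- exact: bndW (two _ _) (bndD h1 (bndN h2)).
- by rewrite mulnDl; exact: bndM.
- by rewrite mulnDl; exact: bndM h1 (bndV h2).
- by apply: bndW (bnd_floor h); rewrite mulSn -addn1 addnC leq_add2r.
- by case: (_ <= _); [exact: bnd1 | exact: bnd0].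
Qed.

Lemma ecost_le e : (ecost m e <= ecost_bound e * L)%N.
Proof.
have val e1 : (ratlen (eval m e1) <= 4 * width e1 * L)%N.
  apply: leq_trans (ratlen_bnd (eval_bnd e1)) _.
  have : (0 < width e1 * L)%N by rewrite muln_gt0 width_gt0.
  by rewrite -mulnA; move: (_ * L)%N => x; lia.
elim: e => [k|e h|e1 h1 e2 h2|e1 h1 e2 h2|e1 h1 e2 h2|e1 h1 e2 h2|e h|e1 h1 e2 h2].
- by have := val (Cst k); rewrite /= !addn0.
- by have /= v := val (Read e); rewrite /= [leqRHS]mulnDl leq_add.
- by have /= v := val (EAdd e1 e2); rewrite /= [leqRHS]mulnDl leq_add // mulnDl leq_add.
- by have /= v := val (ESub e1 e2); rewrite /= [leqRHS]mulnDl leq_add // mulnDl leq_add.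
- by have /= v := val (EMul e1 e2); rewrite /= [leqRHS]mulnDl leq_add // mulnDl leq_add.
- by have /= v := val (EDiv e1 e2); rewrite /= [leqRHS]mulnDl leq_add // mulnDl leq_add.
- by have /= v := val (Floor e); rewrite /= [leqRHS]mulnDl leq_add.
- by have /= v := val (Leq e1 e2); rewrite /= [leqRHS]mulnDl leq_add // mulnDl leq_add.
Qed.

End Size.

(** Every loop is charged [L] rounds, which is sound because [hoare_for] only
    admits loops of at most [L] rounds. *)
Fixpoint cost_bound (c : cmd) (L : nat) : nat :=
  match c with
  | Skip => 1
  | Write a e => 1 + ecost_bound a * L + ecost_bound e * L
  | Flip a => 1 + ecost_bound a * L
  | Seq c1 c2 => 1 + cost_bound c1 L + cost_bound c2 L
  | If e c1 c2 => 1 + ecost_bound e * L + (cost_bound c1 L + cost_bound c2 L)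
  | While e c => (1 + ecost_bound e * L) + L * (1 + ecost_bound e * L + cost_bound c L)
  end%N.

Lemma cost_bound_poly c : exists p : {poly nat}, forall L, cost_bound c L = p.[L]%R.
Proof.
elim: c => [|a e|a|c1 [p1 h1] c2 [p2 h2]|e c1 [p1 h1] c2 [p2 h2]|e c [p h]] /=.
- by exists 1%:P => L; rewrite hornerE.
- by exists (1%:P + (ecost_bound a)%:P * 'X + (ecost_bound e)%:P * 'X) => L; rewrite !hornerE.
- by exists (1%:P + (ecost_bound a)%:P * 'X) => L; rewrite !hornerE.
- by exists (1%:P + p1 + p2) => L; rewrite !hornerE h1 h2.
- by exists (1%:P + (ecost_bound e)%:P * 'X + (p1 + p2)) => L; rewrite !hornerE h1 h2.
- exists (1%:P + (ecost_bound e)%:P * 'X + 'X * (1%:P + (ecost_bound e)%:P * 'X + p)) => L.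
  by rewrite !hornerE h.
Qed.

(** Allows a run on the empty tape to be replayed in front of coins that are
    left to a later command. *)
Lemma exec_cat c m r t m' r' r2 :
  exec c m r t m' r' -> exec c m (r ++ r2) t m' (r' ++ r2).
Proof.
elim=> {c m r t m' r'}.
- move=> m r; apply: exec_skip.
- move=> a e m r; apply: exec_write.
- move=> *; exact: exec_flip.
- move=> *; apply: exec_seq; eassumption.
- move=> *; exact: exec_if.
- move=> *; exact: exec_while_end.
- move=> *; apply: exec_while_step; eassumption.
Qed.

(** * Stores *)

(** The memory is presented as arrays [s a] with [a < 32], interleaved from an
    address [b] on: their lengths depend on the input, so they cannot be laid
    out one after the other.  Cell 0 holds [b], and the array [LOW] consists of
    the cells between 0 and [b], which receive the input and the output. *)
Definition store := nat -> nat -> rat.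

Notation LOW := 32%N (only parsing).

Definition lay (b : nat) (s : store) : mem := fun i =>
  if i == 0%N then b%:R else if (i < b)%N then s LOW i
  else s ((i - b) %% 32)%N ((i - b) %/ 32)%N.

(** The comparisons are by [eqn] so that reading one array after an update of
    another is settled by computation. *)
Definition supd (s : store) (a k : nat) (v : rat) : store :=
  fun a' k' => if eqn a' a && eqn k' k then v else s a' k'.

Definition adr (a : nat) (i : expr) : expr :=
  EAdd (Read (Cst 0)) (EAdd (Cst a) (EMul (Cst 32) i)).
Definition arr a i := Read (adr a i).
Definition var a := arr a (Cst 0).
Definition put a i e := Write (adr a i) e.

Definition agree (l : seq nat) (s s' : store) :=
  forall a k, a \notin l -> s' a k = s a k.

Lemma agree_trans l s1 s2 s3 : agree l s1 s2 -> agree l s2 s3 -> agree l s1 s3.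
Proof. by move=> h1 h2 a k h; rewrite h2 // h1. Qed.

Lemma agree_sub l l' s s' : {subset l <= l'} -> agree l s s' -> agree l' s s'.
Proof.
by move=> h1 h2 a k h; apply: h2; apply: contra h; exact: h1.
Qed.

Lemma agree_supd l s a k v : a \in l -> agree l s (supd s a k v).
Proof.
move=> al a' k' h; rewrite /supd; case: (@eqnP a' a) => //= e.
by rewrite e al in h.
Qed.

Section Hoare.

Variables (b L : nat).
Hypotheses (b0 : (0 < b)%N) (L0 : (0 < L)%N).

Notation ev s e := (eval (lay b s) e).

Lemma evalC m k : eval m (Cst k) = k%:R. Proof. by []. Qed.
Lemma evalD m e1 e2 : eval m (EAdd e1 e2) = eval m e1 + eval m e2.
Proof. by []. Qed.
Lemma evalB m e1 e2 : eval m (ESub e1 e2) = eval m e1 - eval m e2.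
Proof. by []. Qed.
Lemma evalM m e1 e2 : eval m (EMul e1 e2) = eval m e1 * eval m e2.
Proof. by []. Qed.
Lemma evalV m e1 e2 : eval m (EDiv e1 e2) = eval m e1 / eval m e2.
Proof. by []. Qed.
Lemma evalF m e1 : eval m (Floor e1) = (Num.floor (eval m e1))%:~R.
Proof. by []. Qed.
Lemma evalL m e1 e2 : eval m (Leq e1 e2) = (eval m e1 <= eval m e2)%R%:R.
Proof. by []. Qed.
Definition evE := (evalC, evalD, evalB, evalM, evalV, evalF, evalL).

Lemma eval_adr s a i k : (ev s i) = k%:R -> (ev s (adr a i)) = (b + (a + 32 * k))%N%:R.
Proof. move=> /= ->; rewrite (natrD _ b) (natrD _ a). by rewrite natrM. Qed.

Lemma lay_hi s a k : (a < 32)%N -> lay b s (b + (a + 32 * k))%N = s a k.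
Proof.
move=> a32; rewrite /lay addn_eq0 -[b == 0%N]negbK -lt0n b0 /=.
rewrite ltnNge leq_addr /= addKn mulnC addnC.
by rewrite modnMDl modn_small // divnMDl // divn_small // addn0.
Qed.

Lemma eval_arr s a i k : (a < 32)%N -> (ev s i) = k%:R -> (ev s (arr a i)) = s a k.
Proof.
move=> a32 h; change (lay b s (Num.truncn ((ev s (adr a i)))) = s a k).
by rewrite (eval_adr a h) natrK lay_hi.
Qed.

Lemma eval_var s a : (a < 32)%N -> (ev s (var a)) = s a 0%N.
Proof. by move=> a32; apply: eval_arr. Qed.

Lemma eval_low s i k : (ev s i) = k%:R -> (0 < k < b)%N -> (ev s (Read i)) = s LOW k.
Proof.
move=> h /andP[k0 kb]; rewrite /= h natrK /lay kb.
by rewrite -[k == 0%N]negbK -lt0n k0.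
Qed.

Lemma lay_supd s a k v : (a < 32)%N ->
  upd (lay b s) (b + (a + 32 * k))%N%:R v = lay b (supd s a k v).
Proof using b0.
move=> a32; apply/funext => i; rewrite /upd natrK /lay /supd.
case: (eqVneq i 0%N) => [->|i0].
  by rewrite eq_sym addn_eq0 -[b == 0%N]negbK -lt0n b0.
case: ltnP => ib.
  have -> : (i == b + (a + 32 * k))%N = false.
    by apply/negbTE/negP => /eqP e; move: ib; rewrite e ltnNge leq_addr.
  have -> : eqn 32 a = false by apply/negbTE/negP => /eqnP e; rewrite -e in a32.
  by [].
congr (if _ then _ else _).
apply/idP/idP => [/eqP ->|]; last first.
  case/andP => /eqnP h1 /eqnP h2; apply/eqP.
  by rewrite -h1 -h2 (mulnC 32) (addnC (_ %% _)%N) -divn_eq subnKC.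
rewrite addKn mulnC addnC modnMDl modn_small // divnMDl // divn_small //.
by rewrite addn0; apply/andP; split; apply/eqnP.
Qed.

Lemma lay_supd_low s k v : (0 < k < b)%N ->
  upd (lay b s) k%:R v = lay b (supd s LOW k v).
Proof using Type.
move=> /andP[k0 kb]; apply/funext => i; rewrite /upd natrK /lay /supd.
case: (eqVneq i 0%N) => [->|i0]; first by rewrite eq_sym -[k == 0%N]negbK -lt0n k0.
case: ltnP => ib /=; first by [].
have -> : (i == k) = false by rewrite gtn_eqF // (leq_trans kb).
by have -> : eqn ((i - b) %% 32) 32 = false
  by apply/negbTE/negP => /eqnP e; have := ltn_pmod (i - b) (isT : (0 < 32)%N); rewrite e.
Qed.

(** Total correctness together with the running time.  The bound on the cells
    is part of both conditions, since it is what turns the number of steps into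
    a bound on the logarithmic cost. *)
Definition hoare (c : cmd) (s : store) (r : seq bool)
    (Q : store -> seq bool -> Prop) : Prop :=
  mbnd L (lay b s) -> exists t s' r',
    [/\ exec c (lay b s) r t (lay b s') r', (t <= cost_bound c L)%N,
        mbnd L (lay b s') & Q s' r'].

Lemma hoare_conseq c s r (Q Q' : store -> seq bool -> Prop) :
  hoare c s r Q -> (forall s' r', Q s' r' -> Q' s' r') -> hoare c s r Q'.
Proof.
move=> h hQ /h [t [s' [r' [h1 h2 h3 h4]]]]; exists t, s', r'; split=> //.
exact: hQ.
Qed.

Lemma hoare_skip s r (Q : store -> seq bool -> Prop) :
  Q s r -> hoare Skip s r Q.
Proof. by move=> h hb; exists 1%N, s, r; split=> //; apply: exec_skip. Qed.

Lemma hoare_seq c1 c2 s r (Q1 Q2 : store -> seq bool -> Prop) :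
  hoare c1 s r Q1 -> (forall s' r', Q1 s' r' -> hoare c2 s' r' Q2) ->
  hoare (Seq c1 c2) s r Q2.
Proof.
move=> h1 h2 /h1 [t1 [s1 [r1 [e1 t1L b1 q1]]]].
have [t2 [s2 [r2 [e2 t2L b2 q2]]]] := h2 _ _ q1 b1.
exists (1 + t1 + t2)%N, s2, r2; split=> //; first exact: exec_seq e1 e2.
by rewrite /= !leq_add.
Qed.

Lemma mbnd_upd m a v : bnd L v -> mbnd L m -> mbnd L (upd m a v).
Proof. by move=> bv bm i; rewrite /upd; case: ifP. Qed.

Lemma hoare_put a i e s r k v (Q : store -> seq bool -> Prop) :
  (a < 32)%N -> (ev s i) = k%:R -> (ev s e) = v -> bnd L v ->
  Q (supd s a k v) r -> hoare (put a i e) s r Q.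
Proof.
move=> a32 hi he bv q hb.
exists (1 + ecost (lay b s) (adr a i) + ecost (lay b s) e)%N, (supd s a k v), r.
have E : upd (lay b s) ((ev s (adr a i))) ((ev s e)) = lay b (supd s a k v).
  by rewrite he (eval_adr a hi) lay_supd.
split=> //.
- by rewrite -E; apply: exec_write.
- by apply: leq_add (ecost_le L0 hb _); rewrite leq_add2l (ecost_le L0 hb).
- by rewrite -E; apply: mbnd_upd => //; rewrite he.
Qed.

Lemma hoare_put_low i e s r k v (Q : store -> seq bool -> Prop) :
  (0 < k < b)%N -> (ev s i) = k%:R -> (ev s e) = v -> bnd L v ->
  Q (supd s LOW k v) r -> hoare (Write i e) s r Q.
Proof using L0.
move=> kb hi he bv q hb.
exists (1 + ecost (lay b s) i + ecost (lay b s) e)%N, (supd s LOW k v), r.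
have E : upd (lay b s) ((ev s i)) ((ev s e)) = lay b (supd s LOW k v).
  by rewrite he hi lay_supd_low.
split=> //.
- by rewrite -E; apply: exec_write.
- by apply: leq_add (ecost_le L0 hb _); rewrite leq_add2l (ecost_le L0 hb).
- by rewrite -E; apply: mbnd_upd => //; rewrite he.
Qed.

Lemma hoare_flip a s (x : bool) r (Q : store -> seq bool -> Prop) :
  (a < 32)%N -> Q (supd s a 0%N x%:R) r ->
  hoare (Flip (adr a (Cst 0))) s (x :: r) Q.
Proof.
move=> a32 q hb.
exists (1 + ecost (lay b s) (adr a (Cst 0)))%N, (supd s a 0 x%:R), r.
have E : upd (lay b s) ((ev s (adr a (Cst 0)))) x%:R = lay b (supd s a 0 x%:R).
  by rewrite (@eval_adr _ a _ 0%N) // lay_supd.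
split=> //.
- by rewrite -E; apply: exec_flip.
- by rewrite leq_add2l (ecost_le L0 hb).
- by rewrite -E; apply: mbnd_upd => //; case: x {q E}; [exact: bnd1 | exact: bnd0].
Qed.

Lemma hoare_if e c1 c2 s r (Q : store -> seq bool -> Prop) :
  ((ev s e) != 0 -> hoare c1 s r Q) -> ((ev s e) = 0 -> hoare c2 s r Q) ->
  hoare (If e c1 c2) s r Q.
Proof.
move=> h1 h2 hb.
have [t [s' [r' [ex tL b' q]]]] : exists t s' r',
    [/\ exec (if (ev s e) != 0 then c1 else c2) (lay b s) r t (lay b s') r',
        (t <= cost_bound c1 L + cost_bound c2 L)%N, mbnd L (lay b s') & Q s' r'].
  case: (eqVneq ((ev s e)) 0) => [e0|e0].
    have [t [s' [r' [h3 h4 h5 h6]]]] := h2 e0 hb; exists t, s', r'; split=> //.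
    exact: leq_trans h4 (leq_addl _ _).
  have [t [s' [r' [h3 h4 h5 h6]]]] := h1 e0 hb; exists t, s', r'; split=> //.
  exact: leq_trans h4 (leq_addr _ _).
exists (1 + ecost (lay b s) e + t)%N, s', r'; split=> //; first exact: exec_if.
by rewrite /= leq_add // leq_add2l (ecost_le L0 hb).
Qed.

Definition For (a : nat) (N : expr) (body : cmd) : cmd :=
  Seq (put a (Cst 0) (Cst 0))
      (While (Leq (EAdd (var a) (Cst 1)) N)
             (Seq body (put a (Cst 0) (EAdd (var a) (Cst 1))))).

(** The list [l] contains the arrays that the body may change.  The invariant
    must be insensitive to the counter cell, which moves after the body; the
    value of the counter is handed to the body separately. *)
Lemma hoare_for (l : seq nat) a N body s0 r0 nn (J : nat -> store -> seq bool -> Prop)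
    (Q : store -> seq bool -> Prop) :
  (a < 32)%N -> a \notin l -> (nn <= L)%N ->
  (forall s, agree (a :: l) s0 s -> (ev s N) = nn%:R) ->
  (forall k s r v, J k s r -> J k (supd s a 0%N v) r) ->
  J 0%N s0 r0 ->
  (forall k s r, (k < nn)%N -> J k s r -> agree (a :: l) s0 s -> s a 0%N = k%:R ->
     hoare body s r (fun s' r' => J k.+1 s' r' /\ agree l s s')) ->
  (forall s r, J nn s r -> agree (a :: l) s0 s -> Q s r) ->
  hoare (For a N body) s0 r0 Q.
Proof.
move=> a32 al nL hN hJ J0 hB hQ.
apply: (@hoare_seq _ _ _ _ (fun s r =>
  [/\ J 0%N s r, agree (a :: l) s0 s & s a 0%N = 0%:R])).
  apply: (@hoare_put _ _ _ _ _ 0%N 0) => //; first exact: bnd0.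
  split; [exact: hJ | by apply: agree_supd; rewrite inE eqxx |].
  by rewrite /supd !eqnE !eqxx.
have loop d : forall k s r, (k + d = nn)%N -> J k s r -> agree (a :: l) s0 s ->
    s a 0%N = k%:R -> mbnd L (lay b s) ->
  let w := While (Leq (EAdd (var a) (Cst 1)) N)
             (Seq body (put a (Cst 0) (EAdd (var a) (Cst 1)))) in
  let g := Leq (EAdd (var a) (Cst 1)) N in
  exists t s' r', [/\ exec w (lay b s) r t (lay b s') r',
    (t <= (1 + ecost_bound g * L) + d * (1 + ecost_bound g * L +
       cost_bound (Seq body (put a (Cst 0) (EAdd (var a) (Cst 1)))) L))%N,
    mbnd L (lay b s') & Q s' r'].
  elim: d => [|d ih] k s r kd Jk ag sa hb w g.
    rewrite addn0 in kd; exists (1 + ecost (lay b s) g)%N, s, r; split=> //.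
    - apply: exec_while_end; rewrite !evE.
      by rewrite eval_var // sa hN // -natrD ler_nat addn1 -kd ltnn.
    - by rewrite addn0 leq_add2l (ecost_le L0 hb).
    - by apply: hQ; rewrite -?kd.
  have kn : (k < nn)%N by rewrite -kd -addSnnS leq_addr.
  have gE : eval (lay b s) g != 0.
    rewrite !evE eval_var // sa hN //.
    by rewrite -natrD ler_nat addn1 kn oner_eq0.
  have step : hoare (Seq body (put a (Cst 0) (EAdd (var a) (Cst 1)))) s r
      (fun s' r' => [/\ J k.+1 s' r', agree (a :: l) s0 s' & s' a 0%N = k.+1%:R]).
    apply: hoare_seq (hB _ _ _ kn Jk ag sa) _ => s' r' [J' ag'].
    have sa' : s' a 0%N = k%:R by rewrite ag'.
    apply: (@hoare_put _ _ _ _ _ 0%N k.+1%:R) => //.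
    - by rewrite !evE eval_var // sa' -natrD addn1.
    - apply: bnd_natr; apply: leq_trans (leq_trans kn nL) _; exact: leq_expn2.
    - split; first exact: hJ.
        apply: agree_trans ag _; apply: agree_trans; last first.
          by apply: agree_supd; rewrite inE eqxx.
        by apply: agree_sub ag' => x xl; rewrite inE xl orbT.
      by rewrite /supd !eqnE !eqxx.
  have [t1 [s1 [r1 [e1 t1L b1 [J1 ag1 sa1]]]]] := step hb.
  have [|t2 [s2 [r2 [e2 t2L b2 q2]]]] := ih k.+1 s1 r1 _ J1 ag1 sa1 b1.
    by rewrite addSnnS.
  exists (1 + ecost (lay b s) g + t1 + t2)%N, s2, r2; split=> //.
    exact: exec_while_step e1 e2.
  rewrite mulSn addnCA; apply: leq_add => //; apply: leq_add => //.
  by rewrite leq_add2l (ecost_le L0 hb).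
move=> s r [Js ags sa] hb.
have [t [s' [r' [e tL b' q]]]] := loop nn 0%N s r (add0n _) Js ags sa hb.
exists t, s', r'; split=> //; apply: leq_trans tL _.
by rewrite [leqRHS]/= leq_add2l leq_mul2r nL orbT.
Qed.

End Hoare.

(** * Parity of rationals *)

Definition oddq (x : rat) : bool := (x - 1) / 2 \is a Num.int.

Lemma oddq_int x : oddq x -> x \is a Num.int.
Proof.
move=> h; have -> : x = 2 * ((x - 1) / 2) + 1 by field.
by rewrite rpredD // rpredM // (rpred_nat _ 2).
Qed.

Lemma half_nint : (1 / 2 : rat) \isn't a Num.int.
Proof. by rewrite Qint_def. Qed.

Lemma oddq_nhalf x : oddq x -> x / 2 \isn't a Num.int.
Proof.
move=> h; apply: contra half_nint => h2.
have -> : 1 / 2 = x / 2 - (x - 1) / 2 :> rat by field.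
by rewrite rpredB.
Qed.

Lemma oddq_neq0 x : oddq x -> x != 0.
Proof. by apply: contraTneq => ->; rewrite /oddq Qint_def. Qed.

Lemma int_half x : x \is a Num.int -> x / 2 \isn't a Num.int -> oddq x.
Proof.
move=> /intrP [z ->] h; rewrite /oddq.
have e : z = (z %/ 2)%Z * 2 + (z %% 2)%Z by rewrite -divz_eq.
have : (z %% 2)%Z = 0 \/ (z %% 2)%Z = 1 by lia.
case=> r; rewrite r in e; move: h; rewrite e !intrD !intrM.
  by rewrite addr0 mulfK // intr_int.
by rewrite addrK mulfK // intr_int.
Qed.

Lemma int_odd_coprime E y :
  oddq E -> E * y \is a Num.int -> 2 * y \is a Num.int -> y \is a Num.int.
Proof.
move=> h h1 h2; have -> : y = E * y - (E - 1) / 2 * (2 * y) by field.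
by rewrite rpredB // rpredM.
Qed.

(** The denominator of [y] divides both an odd number and a power of 2. *)
Lemma int_odd_pow E y s :
  oddq E -> E * y \is a Num.int -> 2 ^+ s * y \is a Num.int -> y \is a Num.int.
Proof.
move=> h; elim: s => [|s ih] h1 h2; first by rewrite -[y]mul1r -(expr0 2).
apply: ih => //; apply: (int_odd_coprime h); last by rewrite mulrA -exprS.
by rewrite mulrCA rpredM // rpredX // (rpred_nat _ 2).
Qed.

(** * Determinants of 0/1 matrices *)

Definition is01 m n (A : 'M[rat]_(m, n)) := forall i j, (A i j == 0) || (A i j == 1).

Lemma is01_int m n (A : 'M[rat]_(m, n)) i j : is01 A -> A i j \is a Num.int.
Proof. by move=> h; case/orP: (h i j) => /eqP ->. Qed.

Lemma det01_int n (A : 'M[rat]_n) : is01 A -> \det A \is a Num.int.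
Proof.
move=> h; apply: rpred_sum => s _; apply: rpredM; first by rewrite rpredX // rpredN.
by apply: rpred_prod => i _; apply: is01_int.
Qed.

Lemma det01_le n (A : 'M[rat]_n) : is01 A -> `|\det A| <= n`!%:R.
Proof.
move=> h; apply: le_trans (ler_norm_sum _ _ _) _.
have <- : \sum_(s : 'S_n) (1 : rat) = n`!%:R.
  by rewrite sumr_const -card_Sn.
apply: ler_sum => s _; rewrite normrM normrX normrN1 expr1n mul1r normr_prod.
apply: prodr_ile1 => i _; rewrite normr_ge0 /=.
by case/orP: (h i (s i)) => /eqP ->; rewrite ?normr0 ?normr1.
Qed.

Lemma adj01_int n (A : 'M[rat]_n) i j : is01 A -> (\adj A) i j \is a Num.int.
Proof.
move=> h; rewrite mxE rpredM //; first by rewrite rpredX // rpredN.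
by apply: det01_int => a b; rewrite !mxE; apply: h.
Qed.

Lemma adj01_le n (A : 'M[rat]_n) i j : is01 A -> `|(\adj A) i j| <= n`!%:R.
Proof.
move=> h; rewrite mxE normrM normrX normrN1 expr1n mul1r.
have h' : is01 (row' j (col' i A)) by move=> a b; rewrite !mxE; apply: h.
apply: le_trans (det01_le h') _; rewrite ler_nat.
by case: n i {j A h h'} => [[]//|n] _ /=; rewrite factS leq_pmull.
Qed.

Lemma col_mulmx (R : pzRingType) m n p (A : 'M[R]_(m, n)) (B : 'M[R]_(n, p)) j :
  col j (A *m B) = A *m col j B.
Proof. by apply/colP => i; rewrite !mxE; apply: eq_bigr => k _; rewrite mxE. Qed.

(** * Fraction-free elimination *)

Section Elimination.

Variable n : nat.
Implicit Types (C T : 'M[rat]_n) (f : 'rV[rat]_n) (Fs : 'rV[rat]_n -> Prop).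

(** [T] is the system solved by [C]: its rows are the rows [f] that provided a
    pivot, in the position of their pivot, and unit vectors elsewhere.  The
    columns of [C] belonging to the unit vectors are those of E T^-1, the others
    vanish, and 2 ^ s collects the factors divided out so far. *)
Definition witness C (E : rat) T s :=
  [/\ is01 T, E * 2 ^+ s = \det T &
      forall j, col j C = 0 \/ T *m col j C = E *: delta_mx j 0].

(** The columns of [C] are solutions, and by [red_span] every solution [u] is
    their combination with the coefficients u_j / E.  As [E] is odd, no factor
    2 is lost when [C] replaces the space of solutions. *)
Record reduced Fs C (E : rat) := Reduced {
  red_odd : oddq E;
  red_int : forall x j, C x j \is a Num.int;
  red_ker : forall f, Fs f -> f *m C = 0;
  red_span : forall u : 'cV_n, (forall f, Fs f -> f *m u = 0) -> C *m u = E *: u;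
  red_wit : exists T s, witness C E T s }.

(** Cramer's rule. *)
Lemma witness_adj C E T s j : E != 0 -> witness C E T s -> col j C != 0 ->
  2 ^+ s *: col j C = col j (\adj T).
Proof.
move=> E0 [_ dT h] c0; case: (h j) => [e|e]; first by rewrite e eqxx in c0.
have: \adj T *m (T *m col j C) = \adj T *m (E *: delta_mx j 0) by rewrite e.
rewrite mulmxA mul_adj_mx -scalemxAr mul_scalar_mx -colE -dT => h'.
by apply: (scalerI E0); rewrite scalerA.
Qed.

Lemma witness_int C E T s x j : E != 0 -> witness C E T s ->
  2 ^+ s * C x j \is a Num.int.
Proof.
move=> E0 w; case: (eqVneq (col j C) 0) => [e|/(witness_adj E0 w) e].
  by move/colP/(_ x): e; rewrite !mxE => ->; rewrite mulr0.
by move/colP/(_ x): e; rewrite !mxE => ->; have [h _ _] := w; have := adj01_int x j h; rewrite !mxE.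
Qed.

(** A nonzero column is a column of an adjugate divided by a power of 2, hence
    entries do not grow with the number of pivots. *)
Lemma reduced_le Fs C E x j : reduced Fs C E -> `|C x j| <= n`!%:R.
Proof.
move=> [oE _ _ _ [T [s w]]]; have E0 := oddq_neq0 oE.
case: (eqVneq (col j C) 0) => [e|/(witness_adj E0 w) e].
  by move/colP/(_ x): e; rewrite !mxE => ->; rewrite normr0.
have [h _ _] := w; apply: le_trans (adj01_le x j h).
move/colP/(_ x): e; rewrite !mxE => <-; rewrite normrM.
by rewrite ler_peMl // normrX exprn_ege1 // normr_nat.
Qed.

Lemma reduced_sum3_le Fs C E x y z j : reduced Fs C E ->
  `|C x j + C y j + C z j| <= (3 * n`!)%N%:R.
Proof.
move=> red; have le k := reduced_le k j red.
apply: le_trans (ler_normD _ _) _; apply: le_trans (lerD (ler_normD _ _) (lexx _)) _.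
apply: le_trans (lerD (lerD (le _) (le _)) (le _)) _.
by rewrite -!natrD ler_nat; lia.
Qed.

Lemma reduced_E_le Fs C E : reduced Fs C E -> `|E| <= n`!%:R.
Proof.
move=> [_ _ _ _ [T [s [h d _]]]]; apply: le_trans (det01_le h).
by rewrite -d normrM ler_peMr // normrX exprn_ege1 // normr_nat.
Qed.

Lemma reduced0 : reduced (fun=> False) 1%:M 1.
Proof.
split.
- by rewrite /oddq subrr mul0r rpred0.
- by move=> x j; rewrite mxE; case: (_ == _).
- by [].
- by move=> u _; rewrite mul1mx scale1r.
exists 1%:M, 0%N; split.
- by move=> i j; rewrite mxE; case: (i == j).
- by rewrite det1 expr0 mulr1.
- by move=> j; right; rewrite mul1mx scale1r col1.
Qed.

Definition addF Fs f0 : 'rV[rat]_n -> Prop := fun f => Fs f \/ f = f0.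

Lemma reduced_skip Fs C E f : reduced Fs C E -> f *m C = 0 ->
  reduced (addF Fs f) C E.
Proof.
move=> [h1 h2 h3 h4 h5] fC; split=> //.
- by move=> f' [/h3|->].
- by move=> u hu; apply: h4 => f' hf; apply: hu; left.
Qed.

Definition setrow T p f : 'M[rat]_n := \matrix_(i, j) if i == p then f 0 j else T i j.

(** Laplace expansion along row [p], whose cofactors do not involve that row. *)
Lemma det_setrow T p f : \det (setrow T p f) = (f *m col p (\adj T)) 0 0.
Proof.
rewrite (expand_det_row _ p) mxE; apply: eq_bigr => j _.
rewrite !mxE eqxx; congr (_ * ((-1) ^+ _ * \det _)).
by apply/matrixP => a b; rewrite !mxE eq_sym (negbTE (neq_lift _ _)).
Qed.

(** A step of fraction-free (Bareiss) elimination in which the row is divided by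
    [t].  Column [p] becomes zero, so it cannot provide a pivot again. *)
Definition pivot C E f p t : 'M[rat]_n :=
  \matrix_(x, j) (((f *m C) 0 p / t * C x j - C x p * ((f *m C) 0 j / t)) / E).

Lemma pivotE C E f p t : pivot C E f p t =
  E^-1 *: (((f *m C) 0 p / t) *: C - col p C *m (t^-1 *: (f *m C))).
Proof.
apply/matrixP => x j; rewrite [LHS]mxE [RHS]mxE mulrC; congr (_ * _).
rewrite [RHS]mxE [X in _ = X + _]mxE [X in _ = _ + X]mxE; congr (_ - _).
rewrite [(col p C *m _) x j]mxE big_ord1; congr (_ * _); first by rewrite mxE.
by rewrite [RHS]mxE mulrC.
Qed.

(** Replacing row [p] of the witness by [f] multiplies its determinant by the
    pivot.  The new entries are integral because they become so when multiplied
    by the odd number [E], by their definition, and when multiplied by a power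
    of 2, by Cramer's rule for the new witness. *)
Lemma reduced_pivot Fs C E f p k (t := 2 ^+ k) :
  is01 f -> reduced Fs C E ->
  (forall j, (f *m C) 0 j / t \is a Num.int) -> oddq ((f *m C) 0 p / t) ->
  reduced (addF Fs f) (pivot C E f p t) ((f *m C) 0 p / t).
Proof.
move=> f01 [oE iC kC sC [T [s w]]] ig og; have E0 := oddq_neq0 oE.
have t0 : t != 0 by rewrite expf_neq0.
have fC' : f *m pivot C E f p t = 0.
  rewrite pivotE -scalemxAr mulmxBr -scalemxAr mulmxA.
  have -> : f *m col p C = ((f *m C) 0 p)%:M.
    by rewrite -col_mulmx; apply/matrixP => a b; rewrite !ord1 !mxE.
  by rewrite mul_scalar_mx scalerA subrr scaler0.
have [T01 dT wT] := w.
have fcol (j : 'I_n) (A : 'M[rat]_n) : (f *m A) 0 j = (f *m col j A) 0 0.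
  by rewrite -col_mulmx [RHS]mxE.
have fcol0 (j : 'I_n) : col j C = 0 -> (f *m C) 0 j = 0.
  by move=> h; rewrite fcol h mulmx0 mxE.
have cp : T *m col p C = E *: delta_mx p 0.
  case: (wT p) => // /fcol0 c0; move: (oddq_neq0 og).
  by rewrite c0 mul0r eqxx.
have colE j : col j (pivot C E f p t) =
    E^-1 *: (((f *m C) 0 p / t) *: col j C - ((f *m C) 0 j / t) *: col p C).
  apply/colP => x; rewrite mxE [LHS]mxE.
  move: ((f *m C) 0 p / t) ((f *m C) 0 j / t) => a c.
  by rewrite !mxE mulrC (mulrC (C x p)).
have w' : witness (pivot C E f p t) ((f *m C) 0 p / t) (setrow T p f) (s + k)%N.
  split.
  - by move=> i j; rewrite mxE; case: ifP.
  - have -> : \det (setrow T p f) = 2 ^+ s * (f *m C) 0 p.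
      rewrite det_setrow -(witness_adj E0 w).
        by rewrite -scalemxAr [LHS]mxE -fcol.
      apply/eqP => c0; move: cp; rewrite c0 mulmx0 => /colP/(_ p)/esym/eqP.
      by rewrite !mxE !eqxx mulr1 (negbTE E0).
    by rewrite exprD mulrCA; congr (_ * _); rewrite divfK.
  - move=> j; case: (eqVneq j p) => [->|jp].
      by left; rewrite colE subrr scaler0.
    case: (wT j) => cj.
      left; rewrite colE cj scaler0.
      by rewrite (fcol0 _ cj) mul0r scale0r subrr scaler0.
    right; apply/colP => i; rewrite mxE.
    case: (eqVneq i p) => [->|ip].
      transitivity ((f *m col j (pivot C E f p t)) 0 0).
        by rewrite mxE; apply: eq_bigr => a _; rewrite !mxE eqxx.
      by rewrite -fcol fC' !mxE eq_sym (negbTE jp) mulr0.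
    transitivity ((T *m col j (pivot C E f p t)) i 0).
      by rewrite [RHS]mxE; apply: eq_bigr => a _; rewrite !mxE (negbTE ip).
    rewrite colE -scalemxAr mulmxBr -!scalemxAr cj cp !mxE (negbTE ip) /=.
    by rewrite !mulr0 subr0 mulrCA mulKf.
split=> //.
- move=> x j; have h := witness_int x j (oddq_neq0 og) w'.
  apply: (int_odd_pow oE _ h); rewrite mxE mulrC divfK //.
  by rewrite rpredB // rpredM.
- move=> f' [/kC h|->] //.
  rewrite pivotE -scalemxAr mulmxBr -scalemxAr mulmxA h scaler0.
  by rewrite -col_mulmx h col0 mul0mx subrr scaler0.
- move=> u hu; have Cu : C *m u = E *: u by apply: sC => f' hf; apply: hu; left.
  have gu : (t^-1 *: (f *m C)) *m u = 0.
    by rewrite -scalemxAl -mulmxA Cu -scalemxAr hu ?scaler0 //; right.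
  rewrite pivotE -scalemxAl mulmxBl -scalemxAl Cu -mulmxA gu mulmx0 subr0 !scalerA.
  by rewrite mulrC mulVKf.
by exists (setrow T p f), (s + k)%N.
Qed.

End Elimination.

(** * Edges and LO colourings *)

Definition edge_row n (e : {set 'I_n}) : 'rV[rat]_n := \row_j (j \in e)%:R.

Lemma edge_row01 n (e : {set 'I_n}) : is01 (edge_row e).
Proof. by move=> i j; rewrite mxE; case: (j \in e); rewrite eqxx ?orbT. Qed.

Lemma edge_rowM n m (e : {set 'I_n}) (A : 'M[rat]_(n, m)) j :
  (edge_row e *m A) 0 j = \sum_(x in e) A x j.
Proof.
rewrite mxE [RHS]big_mkcond; apply: eq_bigr => x _; rewrite mxE.
by case: (x \in e); rewrite ?mul1r ?mul0r.
Qed.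

Lemma incidence_ker n (H : hypergraph 'I_n) (v : 'cV[rat]_n) :
  (forall e, e \in H -> edge_row e *m v = 0) -> incidence H *m v = 0.
Proof.
move=> h; apply/matrixP => i j; rewrite ord1 [RHS]mxE.
have -> : (incidence H *m v) i 0 = (edge_row (enum_val i) *m v) 0 0.
  by rewrite !mxE; apply: eq_bigr => x _; rewrite !mxE.
by rewrite h ?mxE // enum_valP.
Qed.

Definition edges n (H : hypergraph 'I_n) : 'rV[rat]_n -> Prop :=
  fun f => exists2 e, e \in H & f = edge_row e.

(** The vector [u] with entry 2 at the vertices of colour 1 and -1 at those of
    colour 0 is a solution, so C u = E u.  If 4 divided row [x] of [C], it would
    divide E u_x, which has at most one factor 2. *)
Lemma LO2_row n (H : hypergraph 'I_n) (c : 'I_n -> 'I_2) C E x :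
  uniform3 H -> LO_colouring H c -> reduced (edges H) C E ->
  exists j, C x j / 4 \isn't a Num.int.
Proof.
move=> H3 lo [oE iC kC sC _].
pose u : 'cV[rat]_n := \col_y (if c y == ord_max then 2 else -1).
have hu f : edges H f -> f *m u = 0.
  case=> e eH ->; apply/matrixP => i j; rewrite !ord1 edge_rowM mxE.
  have one : #|[set y in e | c y == ord_max]| = 1%N.
    have := lo e eH; case: (pickP [pred y in e | c y == ord_max]) => /= [y0|no].
      case/andP=> ye /eqP cy.
      have -> : (\max_(y in e) nat_of_ord (c y) = 1)%N.
        apply/eqP; rewrite eqn_leq; apply/andP; split.
          by apply/bigmax_leqP => y _; rewrite -ltnS ltn_ord.
        by have := @leq_bigmax_cond _ (ssrbool.mem e) (fun y => nat_of_ord (c y)) y0 ye; rewrite cy.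
      by [].
    have -> : (\max_(y in e) nat_of_ord (c y) = 0)%N.
      apply/eqP; rewrite -leqn0; apply/bigmax_leqP => y ye.
      have := no y; rewrite /= ye /= => /negbT.
      by rewrite -val_eqE /=; case: (c y) => [[|[|?]]].
    have -> : [set y in e | nat_of_ord (c y) == 0%N] = e.
      apply/setP => y; rewrite inE; case ye: (y \in e) => //=.
      have := no y; rewrite /= ye /= => /negbT.
      by rewrite -val_eqE /=; case: (c y) => [[|[|?]]].
    by rewrite H3.
  have -> : \sum_(y in e) u y 0 = \sum_(y in e) (if c y == ord_max then 3 else 0) - \sum_(y in e) 1.
    rewrite -sumrB; apply: eq_bigr => y _; rewrite mxE; case: ifP => _; lra.
  rewrite -big_mkcondr /= sumr_const sumr_const H3 //.
  have -> : #|(fun y : 'I_n => (y \in e) && (c y == ord_max))| = 1%N.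
    by apply: etrans one; apply: eq_card => y; rewrite inE.
  by rewrite mulr1n subrr.
apply/not_existsP => h.
have i4 j : C x j / 4 \is a Num.int by apply/negPn/negP => /h.
have Eu : E * u x 0 / 4 \is a Num.int.
  have /colP/(_ x) := sC u hu; rewrite [RHS]mxE => <-.
  rewrite mxE mulr_suml rpred_sum // => j _; rewrite mulrAC rpredM //.
  by rewrite mxE; case: ifP => _ //; rewrite (rpred_nat _ 2).
have /negP := oddq_nhalf oE; apply; move: Eu; rewrite mxE; case: ifP => _.
  by have -> : E * 2 / 4 = E / 2 by field.
move=> h2; have -> : E / 2 = (E * -1 / 4) * (- 2) by field.
by rewrite rpredM // rpredN (rpred_nat _ 2).
Qed.

(** After division by the lowest of the three powers, the number of odd summands
    has to be even. *)
Lemma three_odd (a b c : rat) (i j k : nat) :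
  oddq a -> oddq b -> oddq c -> a * 2 ^+ i + b * 2 ^+ j + c * 2 ^+ k = 0 ->
  [\/ i = j /\ (i < k)%N, i = k /\ (i < j)%N | j = k /\ (j < i)%N].
Proof.
have i2 : (2 : rat) \is a Num.int by rewrite (rpred_nat _ 2).
have low x y z p q r : oddq x -> y \is a Num.int -> z \is a Num.int ->
    x * 2 ^+ p + y * 2 ^+ q + z * 2 ^+ r = 0 -> (p < q)%N -> (p < r)%N -> False.
  move=> ox iy iz e pq pr; have /negP := oddq_nhalf ox; apply.
  have -> : x / 2 = - (y * 2 ^+ (q - p.+1) + z * 2 ^+ (r - p.+1)).
    rewrite -(subnK pq) -(subnK pr) !exprD exprS in e.
    have t0 : (2 : rat) ^+ p != 0 by rewrite expf_neq0.
    move: (2 ^+ p) (2 ^+ (q - p.+1)) (2 ^+ (r - p.+1)) e t0 => P Q S e t0.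
    have /eqP : (x + 2 * (y * Q) + 2 * (z * S)) * P = 0 by rewrite -e; ring.
    rewrite mulf_eq0 (negbTE t0) orbF => /eqP h.
    have -> : x / 2 = (x + 2 * (y * Q) + 2 * (z * S)) / 2 - (y * Q + z * S) by field.
    by rewrite h mul0r sub0r.
  by rewrite rpredN rpredD // rpredM // rpredX.
move=> oa ob oc e.
have ia := oddq_int oa; have ib := oddq_int ob; have ic := oddq_int oc.
have n1 : ~~ ((i < j) && (i < k))%N by apply/negP => /andP[h1 h2]; exact: (low a b c i j k).
have n2 : ~~ ((j < i) && (j < k))%N.
  by apply/negP => /andP[h1 h2]; apply: (low b a c j i k) => //; rewrite -e; ring.
have n3 : ~~ ((k < i) && (k < j))%N.
  by apply/negP => /andP[h1 h2]; apply: (low c a b k i j) => //; rewrite -e; ring.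
have n4 : ~~ ((i == j) && (j == k)).
  apply/negP => /andP[/eqP h1 /eqP h2]; subst.
  have t0 : (2 : rat) ^+ k != 0 by rewrite expf_neq0.
  have s0 : a + b + c = 0 by apply: (mulIf t0); rewrite !mulrDl mul0r.
  have /negP := half_nint; apply.
  have -> : 1 / 2 = - ((a - 1) / 2 + (b - 1) / 2 + (c - 1) / 2) - 1 :> rat by lra.
  by rewrite rpredB // rpredN !rpredD.
have : (i = j /\ i < k)%N \/ (i = k /\ i < j)%N \/ (j = k /\ j < i)%N by lia.
by case=> [?|[?|?]]; [constructor 1|constructor 2|constructor 3].
Qed.

Lemma enum3 (T : finType) (e : {set T}) : #|e| = 3%N ->
  exists x y z, enum e = [:: x; y; z].
Proof.
rewrite cardE; case: (enum e) => [|x [|y [|z [|? ?]]]] // _.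
by exists x, y, z.
Qed.

Lemma LO_val n (H : hypergraph 'I_n) K (c : 'I_n -> 'I_K) (v : 'cV[rat]_n) y :
  uniform3 H -> (forall e, e \in H -> edge_row e *m v = 0) ->
  (forall i, oddq (y i) /\ v i 0 = y i * 2 ^+ c i) -> LO_colouring H c.
Proof.
move=> H3 hv hy e eH.
have [p [q [r en]]] := enum3 (H3 _ eH).
have eE t : (t \in e) = [|| t == p, t == q | t == r].
  by rewrite -mem_enum en !inE.
have : uniq [:: p; q; r] by rewrite -en enum_uniq.
rewrite /= !inE negb_or andbT => /andP[/andP[pq pr] qr].
have s0 : v p 0 + v q 0 + v r 0 = 0.
  have /matrixP/(_ 0 0) := hv e eH; rewrite edge_rowM mxE.
  by rewrite -big_enum en !big_cons big_nil /= addr0 addrA.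
rewrite -big_enum en !big_cons big_nil /= maxn0.
have [op ep] := hy p; have [oq eq] := hy q; have [or er] := hy r.
rewrite ep eq er in s0.
have conc t (M : nat) : t \in e -> nat_of_ord (c t) = M ->
    (forall t', t' \in e -> t' != t -> nat_of_ord (c t') != M) ->
    #|[set x in e | nat_of_ord (c x) == M]| = 1%N.
  move=> te ct h; rewrite -(cards1 t); congr #|pred_of_set _|; apply/setP => t'.
  rewrite !inE; case: (eqVneq t' t) => [->|tt']; first by rewrite te ct eqxx.
  by case t'e: (t' \in e) => //=; apply/negbTE/h.
case: (three_odd op oq or s0) => -[h1 h2].
- apply: (conc r); rewrite ?eE ?eqxx ?orbT //; first by lia.
  by move=> t'; rewrite eE => /or3P[] /eqP -> //; rewrite ?eqxx //; lia.
- apply: (conc q); rewrite ?eE ?eqxx ?orbT //; first by lia.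
  by move=> t'; rewrite eE => /or3P[] /eqP -> //; rewrite ?eqxx //; lia.
- apply: (conc p); rewrite ?eE ?eqxx ?orbT //; first by lia.
  by move=> t'; rewrite eE => /or3P[] /eqP -> //; rewrite ?eqxx //; lia.
Qed.

(** * Random combinations *)

Section Random.

Variable n : nat.

Definition coef (r : seq bool) (j : nat) : rat :=
  \sum_(k < n) (nth false r (j * n + k))%:R * 2 ^+ k.

Definition comb (c : 'I_n -> rat) (r : seq bool) : rat := \sum_(j < n) coef r j * c j.

Definition flipat N (p : nat) (r : N.-tuple bool) : N.-tuple bool :=
  [tuple (if val i == p then ~~ tnth r i else tnth r i) | i < N].

Lemma flipatK N p : involutive (@flipat N p).
Proof.
move=> r; apply: eq_from_tnth => i.
by rewrite tnth_mktuple; case: ifP => ip; rewrite tnth_mktuple ip ?negbK.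
Qed.

Lemma nth_flipat N p (r : N.-tuple bool) i : (p < N)%N ->
  nth false (flipat p r) i = if i == p then ~~ nth false r p else nth false r i.
Proof.
move=> pN; case: (ltnP i N) => iN; last first.
  rewrite ifN_eq; first by rewrite !nth_default ?size_tuple.
  by apply: contraTneq iN => ->; rewrite -ltnNge.
have := tnth_mktuple (fun j => if val j == p then ~~ tnth r j else tnth r j) (Ordinal iN).
rewrite (tnth_nth false) /= => ->; rewrite !(tnth_nth false) /=.
by case: (eqVneq i p) => // ->.
Qed.

Lemma idx_inj (i j k l : nat) : (k < n)%N -> (l < n)%N ->
  (i * n + k == j * n + l)%N = (i == j) && (k == l).
Proof.
move=> kn ln; have n0 : (0 < n)%N by case: (n) kn.
apply/eqP/andP => [e|[/eqP-> /eqP->]] //.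
have := congr1 (divn^~ n) e; rewrite !divnMDl // !divn_small // !addn0 => ij.
by move: e; rewrite ij => /addnI ->; rewrite !eqxx.
Qed.

Lemma comb_flipat N (c : 'I_n -> rat) (r : N.-tuple bool) (j0 k0 : 'I_n) :
  (n * n <= N)%N -> let p := (j0 * n + k0)%N in
  comb c (flipat p r) =
  comb c r + (if nth false r p then - 1 else 1) * 2 ^+ k0 * c j0.
Proof.
move=> nN p.
have pN : (p < N)%N.
  apply: leq_trans nN; apply: (@leq_trans (j0.+1 * n)%N).
    by rewrite /p mulSn [ltnRHS]addnC ltn_add2l.
  by rewrite leq_mul2r ltn_ord orbT.
rewrite /comb (bigD1 j0) //= [in RHS](bigD1 j0) //= addrAC -mulrDl; congr (_ * _ + _); last first.
  apply: eq_bigr => j jj; congr (_ * _); apply: eq_bigr => k _.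
  by rewrite nth_flipat // idx_inj // [_ == _ :> nat](negbTE jj).
rewrite /coef (bigD1 k0) //= [in RHS](bigD1 k0) //= addrAC; congr (_ + _); last first.
  apply: eq_bigr => k kk.
  by rewrite nth_flipat // idx_inj // eqxx [_ == _ :> nat](negbTE kk).
rewrite nth_flipat // eqxx -mulrDl; congr (_ * _).
by rewrite -/p; case: (nth _ _ _) => /=; lra.
Qed.

(** Flip the coin of weight 2 ^ k in the coefficient of [c j0].  This changes the
    combination by an odd multiple of 2 ^ (k + a), so it maps the tapes for which
    2 ^ (k.+1 + a) divides the combination injectively to tapes for which
    2 ^ (k + a) divides it and 2 ^ (k.+1 + a) does not. *)
Lemma halving N (c : 'I_n -> rat) (j0 : 'I_n) a k :
  (n * n <= N)%N -> (forall j, c j / 2 ^+ a \is a Num.int) ->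
  oddq (c j0 / 2 ^+ a) -> (k <= n)%N ->
  (#|[set r : N.-tuple bool | comb c r / 2 ^+ (k + a) \is a Num.int]| * 2 ^ k
   <= 2 ^ N)%N.
Proof.
move=> nN ic oc; elim: k => [|k ih] kn.
  by rewrite muln1; apply: leq_trans (max_card _) _; rewrite card_tuple card_bool.
apply: leq_trans (ih (ltnW kn)).
pose S k := [set r : N.-tuple bool | comb c r / 2 ^+ (k + a) \is a Num.int].
rewrite -!/(S _) expnSr mulnA [leqRHS]mulnC mulnAC [leqRHS]mulnC leq_mul2r.
apply/orP; right; rewrite muln2 -addnn.
pose p := (j0 * n + Ordinal kn)%N.
have t0 m : (2 : rat) ^+ m != 0 by rewrite expf_neq0.
have i2 : (2 : rat) \is a Num.int by rewrite (rpred_nat _ 2).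
rewrite -{2}(card_imset _ (inv_inj (@flipatK N p))) -cardsUI.
have disj : S k.+1 :&: [set flipat p r | r in S k.+1] = finset.set0.
  apply/setP => r; rewrite !inE; apply/negP => /andP[h /imsetP[r' h' e]].
  move: h h'; rewrite e !inE comb_flipat // mulrDl => h h'.
  have := rpredB h h'; rewrite addrAC subrr add0r; set s := if _ then _ else _.
  have -> : s * 2 ^+ k * c j0 / 2 ^+ (k.+1 + a) = s * ((c j0 / 2 ^+ a) / 2).
    by rewrite addSn exprS exprD; field; rewrite !t0.
  move=> hs; have /negP := oddq_nhalf oc; apply.
  have -> : (c j0 / 2 ^+ a) / 2 = s * (s * ((c j0 / 2 ^+ a) / 2)).
    by rewrite mulrA /s; case: (nth _ _ _); ring.
  by rewrite rpredM // /s; case: (nth _ _ _).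
rewrite disj cards0 addn0; apply: subset_leq_card; apply/fintype.subsetP => r.
have sub r' : r' \in S k.+1 -> r' \in S k.
  rewrite !inE => h; have -> : comb c r' / 2 ^+ (k + a) = comb c r' / 2 ^+ (k.+1 + a) * 2.
    by rewrite addSn exprS; field; rewrite t0.
  by rewrite rpredM.
rewrite inE => /orP[/sub //|/imsetP[r' /sub h ->]].
move: h; rewrite !inE comb_flipat // mulrDl => h; rewrite rpredD //.
set s := if _ then _ else _.
have -> : s * 2 ^+ k * c j0 / 2 ^+ (k + a) = s * (c j0 / 2 ^+ a).
  by rewrite exprD; field; rewrite !t0.
by rewrite rpredM // /s; case: (nth _ _ _).
Qed.

(** Either some [c j] is odd, or all are even and one is not divisible by 4;
    these are the cases [a = 0] and [a = 1] of [halving]. *)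
Lemma comb_tail N (c : 'I_n -> rat) k :
  (n * n <= N)%N -> (forall j, c j \is a Num.int) ->
  (exists j, c j / 4 \isn't a Num.int) -> (k <= n)%N ->
  (#|[set r : N.-tuple bool | comb c r / 2 ^+ k \is a Num.int]| * 2 ^ k
   <= 2 * 2 ^ N)%N.
Proof.
move=> nN ic [j4 h4] kn.
case: (pselect (exists j, oddq (c j))) => [[j0 o0]|no].
  have := @halving N c j0 0 k nN; rewrite !addn0 expr0 divr1 => h.
  apply: leq_trans (h _ o0 kn) _; last by rewrite leq_pmull.
  by move=> j; rewrite divr1.
have h2 j : c j / 2 \is a Num.int.
  by apply/negPn/negP => h; apply: no; exists j; apply: int_half.
have o4 : oddq (c j4 / 2 ^+ 1).
  rewrite expr1; apply: int_half => //; apply: contra h4.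
  by have -> : c j4 / 2 / 2 = c j4 / 4 by field.
case: k kn => [|k] kn.
  rewrite muln1; apply: leq_trans (max_card _) _.
  by rewrite card_tuple card_bool leq_pmull.
have := @halving N c j4 1 k nN _ o4 (ltnW kn); rewrite addn1 => h.
rewrite expnS mulnCA leq_mul2l /=; apply: h => j.
by rewrite expr1.
Qed.

End Random.

Lemma union_tail n N k (c : 'I_n -> 'I_n -> rat) :
  (n * n <= N)%N -> (forall x j, c x j \is a Num.int) ->
  (forall x, exists j, c x j / 4 \isn't a Num.int) -> (k <= n)%N -> (4 * n < 2 ^ k)%N ->
  (2 ^ N <= 2 * #|[set r : N.-tuple bool |
       [forall x, comb (c x) r / 2 ^+ k \isn't a Num.int]]|)%N.
Proof.
move=> nN ic h4 kn nk.
set G := [set r | _].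
pose B x := [set r : N.-tuple bool | comb (c x) r / 2 ^+ k \is a Num.int].
have GB : (#|~: G| <= \sum_x #|B x|)%N.
  rewrite -sum1_card big_mkcond /=.
  apply: (@leq_trans (\sum_r \sum_x (r \in B x))%N); last first.
    rewrite exchange_big /= leq_sum // => x _.
    by rewrite -sum1_card [leqRHS]big_mkcond leq_sum // => r _; case: (r \in B x).
  apply: leq_sum => r _; case: ifP => //; rewrite !inE => /forallPn [x hx].
  by rewrite (bigD1 x) //= inE (negbNE hx).
have Bk x : (#|B x| * 2 ^ k <= 2 * 2 ^ N)%N by apply: comb_tail.
have sB : ((\sum_x #|B x|) * 2 ^ k <= n * (2 * 2 ^ N))%N.
  rewrite big_distrl /=; apply: leq_trans (leq_sum _ (fun x _ => Bk x)) _.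
  by rewrite sum_nat_const card_ord.
have := cardsC G; rewrite card_tuple card_bool => cG.
have n0 : (n = 0 \/ 0 < n)%N by case: (n); [left|right].
case: n0 => n0.
  by move: GB; rewrite [X in (_ <= X)%N]big1 => [|x _]; [lia | have := ltn_ord x; lia].
have : (#|~: G| * (4 * n) <= n * (2 * 2 ^ N))%N.
  apply: leq_trans sB; apply: leq_mul => //; exact: ltnW.
move: n0 cG; move: #|G| #|~: G| (2 ^ N)%N => g h N2 n0 cG hN.
have : (2 * n * (2 * h) <= 2 * n * N2)%N by lia.
by rewrite leq_pmul2l; lia.
Qed.

Lemma log2_ge (R : realType) (x : R) k : 2 ^+ k <= x -> k%:R <= log2 x.
Proof.
move=> h; have l2 : 0 < ln (2 : R) by rewrite ln_gt0 // ltr1n.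
rewrite /log2 ler_pdivlMr // mulrC mulr_natr -lnXn // ler_ln // posrE ?exprn_gt0 //.
by apply: lt_le_trans h; rewrite exprn_gt0.
Qed.

Lemma colours_le (R : realType) n : (8 <= n)%N ->
  (trunc_log 2 n + 3)%:R <= 3 / 2 * log2 (n%:R : R) + 3 * log2 (log2 (n%:R : R)).
Proof.
move=> n8; have n0 : (0 < n)%N by apply: leq_trans n8.
have h1 : (trunc_log 2 n)%:R <= log2 (n%:R : R).
  by apply: log2_ge; rewrite -natrX ler_nat trunc_logP.
have h3 : 3%:R <= log2 (n%:R : R) by apply: log2_ge; rewrite -natrX ler_nat.
have h2 : 1%:R <= log2 (log2 (n%:R : R)) by apply: log2_ge; rewrite expr1; lra.
rewrite natrD; lra.
Qed.

Lemma bnd_int L (q : rat) : q \is a Num.int -> `|q| <= (2 ^ L)%N%:R -> bnd L q.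
Proof.
move=> /intrP [z ->]; rewrite -intr_norm -abszE => h.
have -> : z%:~R = z%:~R / 1%:~R :> rat by rewrite divr1.
apply: bnd_frac => //; last by rewrite absz1 expn_gt0.
by move: h; rewrite -pmulrn ler_nat.
Qed.

Lemma int_bnd L (q : rat) : q \is a Num.int -> bnd L q -> `|q| <= (2 ^ L)%N%:R.
Proof.
move=> /intrP [z ->] /andP[+ _]; rewrite numq_int => h.
by rewrite -intr_norm -abszE -pmulrn ler_nat.
Qed.

Lemma fact_le n : (n`! <= 2 ^ (n * n))%N.
Proof.
have h k : (k <= n -> k`! <= 2 ^ (n * k))%N.
  elim: k => [|k ih] kn; first by rewrite muln0.
  rewrite factS mulnS expnD; apply: leq_mul; last exact: ih (ltnW kn).
  exact: leq_trans (leq_expn2 _) (leq_pow2 kn).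
exact: h.
Qed.

(** * Elimination program *)

(** The arrays of the programs.  A scalar is the entry 0 of its array; [cI],
    [cJ] and [cK] are loop counters, and [aC] holds a matrix row by row. *)
Notation aN := 1%N (only parsing).
Notation aM := 2%N (only parsing).
Notation aE := 3%N (only parsing).
Notation aC := 4%N (only parsing).
Notation aG := 5%N (only parsing).
Notation aT := 6%N (only parsing).
Notation aP := 7%N (only parsing).
Notation aFound := 8%N (only parsing).
Notation aCol := 9%N (only parsing).
Notation aLead := 10%N (only parsing).
Notation aCoef := 11%N (only parsing).
Notation aBit := 12%N (only parsing).
Notation aWt := 13%N (only parsing).
Notation aSol := 14%N (only parsing).
Notation cI := 20%N (only parsing).
Notation cJ := 21%N (only parsing).
Notation cK := 22%N (only parsing).

Definition idx (i j : expr) := EAdd (EMul i (var aN)) j.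
Definition nint (e : expr) := ESub e (Floor e).

(** The input cells of the edge number [cI] are 3 * cI + 2 and the next two. *)
Definition vertex (k : nat) := Read (EAdd (Cst k.+2) (EMul (Cst 3) (var cI))).

Definition row_prog :=
  For cJ (var aN) (put aG (var cJ)
    (EAdd (EAdd (arr aC (idx (vertex 0) (var cJ))) (arr aC (idx (vertex 1) (var cJ))))
          (arr aC (idx (vertex 2) (var cJ))))).

(** Doubles [aT] until some entry of the row [aG] is not divisible by twice its
    value.  There is nothing to find after n ^ 2 + 2 rounds, because the entries
    are bounded by 3 n!, which is less than 2 ^ (n ^ 2 + 2). *)
Definition search_prog :=
  Seq (put aT (Cst 0) (Cst 1)) (Seq (put aFound (Cst 0) (Cst 0))
  (For cJ (EAdd (EMul (var aN) (var aN)) (Cst 2))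
    (Seq (For cK (var aN)
           (If (var aFound) Skip
             (If (nint (EDiv (arr aG (var cK)) (EMul (Cst 2) (var aT))))
                 (Seq (put aP (Cst 0) (var cK)) (put aFound (Cst 0) (Cst 1))) Skip)))
         (If (var aFound) Skip (put aT (Cst 0) (EMul (Cst 2) (var aT))))))).

(** [aCol] saves the pivot column, which is overwritten like the others. *)
Definition update_prog :=
  If (var aFound)
    (Seq (For cJ (var aN) (put aCol (var cJ) (arr aC (idx (var cJ) (var aP)))))
    (Seq (put aLead (Cst 0) (EDiv (arr aG (var aP)) (var aT)))
    (Seq (For cJ (var aN) (For cK (var aN)
           (put aC (idx (var cJ) (var cK))
             (EDiv (ESub (EMul (var aLead) (arr aC (idx (var cJ) (var cK))))
                         (EMul (arr aCol (var cJ)) (EDiv (arr aG (var cK)) (var aT))))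
                   (var aE)))))
    (put aE (Cst 0) (var aLead)))))
    Skip.

Definition init_prog :=
  Seq (put aE (Cst 0) (Cst 1))
      (For cJ (var aN) (put aC (idx (var cJ) (var cJ)) (Cst 1))).

Definition elim_prog :=
  Seq init_prog (For cI (var aM) (Seq row_prog (Seq search_prog update_prog))).

Section Specs.

Variables (n b L : nat).
Hypothesis (b0 : (0 < b)%N).
Hypothesis (nL : (n * n + 2 * n + 2 <= L)%N).

Notation ev s e := (eval (lay b s) e).

Let L0 : (0 < L)%N. Proof. by apply: leq_trans nL; rewrite addn2. Qed.
Let nL1 : (n <= L)%N. Proof. by apply: leq_trans nL; lia. Qed.

Let factL : (3 * n`! <= 2 ^ L)%N.
Proof.
apply: (@leq_trans (2 ^ 2 * 2 ^ (n * n))%N); first by rewrite leq_mul ?fact_le.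
by rewrite -expnD leq_pow2 //; lia.
Qed.

Lemma eval_idx s i j x y : s aN 0%N = n%:R -> ev s i = x%:R -> ev s j = y%:R ->
  ev s (idx i j) = (x * n + y)%N%:R.
Proof. by move=> hn hi hj; rewrite /idx !evE eval_var // hn hi hj -natrM -natrD. Qed.

Lemma eval_nint s e : (ev s (nint e) == 0) = (ev s e \is a Num.int).
Proof. by rewrite /nint !evE subr_eq0 eq_sym intrEfloor. Qed.

Definition holds (s : store) (C : 'M[rat]_n) (E : rat) :=
  [/\ s aN 0%N = n%:R, s aE 0%N = E
    & forall x j : 'I_n, s aC (x * n + j)%N = C x j].

Lemma holds_agree l s s' C E : all (fun a => a \notin l) [:: aN; aE; aC] ->
  agree l s s' -> holds s C E -> holds s' C E.
Proof.
move=> /and4P[h1 h3 h4 _] ag [a c d]; split; rewrite ?ag //.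
by move=> x j; rewrite ag.
Qed.

Lemma row_spec s r C E (e : nat) (x y z : 'I_n) Fs :
  holds s C E -> reduced Fs C E -> s cI 0%N = e%:R -> (3 * e + 4 < b)%N ->
  s LOW (3 * e + 2)%N = x%:R -> s LOW (3 * e + 3)%N = y%:R ->
  s LOW (3 * e + 4)%N = z%:R ->
  hoare b L row_prog s r (fun s' r' => [/\ r' = r, agree [:: cJ; aG] s s' &
     forall j : 'I_n, s' aG j = C x j + C y j + C z j]).
Proof.
move=> hS red se eb hx hy hz; have [hn _ hC] := hS.
apply: (@hoare_for b L b0 L0 [:: aG] cJ _ _ s r n
  (fun k s' r' => r' = r /\ forall j : 'I_n, (j < k)%N -> s' aG j = C x j + C y j + C z j)) => //.
- by move=> s' ag; rewrite eval_var // (ag aN 0%N isT).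
- move=> k s' r' kn [-> hk] ag s21.
  have agv (v : 'I_n) q : s LOW (3 * e + q.+2)%N = v%:R -> (3 * e + q.+2 < b)%N ->
      ev s' (arr aC (idx (vertex q) (var cJ))) = C v (Ordinal kn).
    move=> hv qb; rewrite (eval_arr b0 (k := (v * n + k)%N)) //.
      by rewrite (ag aC _ isT) -hC.
    apply: eval_idx; [by rewrite (ag aN _ isT) | | by rewrite eval_var].
    rewrite /vertex (eval_low (k := (3 * e + q.+2)%N)) ?(ag LOW _ isT) //.
      by rewrite !evE eval_var // (ag cI _ isT) // se natrD natrM addrC.
    by rewrite qb addnS.
  apply: (hoare_put b0 L0 (k := k) (v := C x (Ordinal kn) + C y (Ordinal kn) + C z (Ordinal kn))) => //.
  + by rewrite eval_var.
  + by rewrite !evE (agv x 0%N hx) ?(agv y 1%N hy) ?(agv z 2%N hz) //; lia.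
  + apply: bnd_int; first by rewrite !rpredD ?(red_int red).
    by apply: le_trans (reduced_sum3_le _ _ _ _ red) _; rewrite ler_nat.
  + split; last exact: agree_supd.
    split=> // j; rewrite ltnS leq_eqVlt /supd /=.
    case: (@eqnP j k) => [jk _ /=|/eqP jk /=]; last by rewrite (negbTE jk) /=; apply: hk.
    by have -> : j = Ordinal kn by apply/val_inj.
- by move=> s' r' [-> h] ag; split=> // j; apply: h.
Qed.

Definition pivoted (g : 'I_n -> rat) (s : store) :=
  s aFound 0%N = 1 /\ exists (p : 'I_n) k, [/\ s aP 0%N = p%:R, s aT 0%N = 2 ^+ k,
    forall j, g j / 2 ^+ k \is a Num.int & oddq (g p / 2 ^+ k)].

Lemma search_spec s r (g : 'I_n -> rat) :
  s aN 0%N = n%:R -> (forall j : 'I_n, s aG j = g j) ->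
  (forall j, g j \is a Num.int) -> (forall j, `|g j| <= (3 * n`!)%N%:R) ->
  hoare b L search_prog s r (fun s' r' => [/\ r' = r, agree [:: aT; aP; aFound; cJ; cK] s s' &
     (s' aFound 0%N = 0 /\ forall j, g j = 0) \/ pivoted g s']).
Proof.
move=> hn hg ig gL.
apply: (hoare_seq (Q1 := fun s' r' => [/\ r' = r, agree [:: aT; aP; aFound; cJ; cK] s s' & s' aT 0%N = 1])).
  apply: (hoare_put b0 L0 (k := 0%N) (v := 1)) => //; first exact: bnd1.
  by split=> //; exact: agree_supd.
move=> s1 r1 [-> ag1 s61].
apply: (hoare_seq (Q1 := fun s' r' => [/\ r' = r, agree [:: aT; aP; aFound; cJ; cK] s s',
   s' aT 0%N = 1 & s' aFound 0%N = 0])).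
  apply: (hoare_put b0 L0 (k := 0%N) (v := 0)) => //; first exact: bnd0.
  by split=> //; apply: agree_trans ag1 _; exact: agree_supd.
move=> {s61} s2 r2 [-> ag2 s62 s82].
apply: (@hoare_for b L b0 L0 [:: aT; aP; aFound; cK] cJ _ _ s2 r (n * n + 2)%N
  (fun i s' r' => r' = r /\ ((s' aFound 0%N = 0 /\ s' aT 0%N = 2 ^+ i /\
       forall j, g j / 2 ^+ i \is a Num.int) \/ pivoted g s'))) => //.
- by apply: leq_trans nL; lia.
- move=> s' ag; rewrite !evE eval_var // (ag aN _ isT) (ag2 aN _ isT) hn.
  by rewrite natrD natrM.
- by split=> //; left; split=> //; split=> // j; rewrite divr1.
- move=> i s3 r3 iN [-> cas] ag3 s213.
  have g3 (s' : store) l : agree l s3 s' -> (aN \notin l) -> (aG \notin l) ->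
      s' aN 0%N = n%:R /\ forall j : 'I_n, s' aG j = g j.
    move=> ag h1 h5; split; first by rewrite ag // (ag3 aN _ isT) (ag2 aN _ isT).
    by move=> j; rewrite ag // (ag3 aG _ isT) (ag2 aG _ isT).
  apply: (hoare_seq (Q1 := fun s' r' => [/\ r' = r, agree [:: cK; aP; aFound] s3 s' &
    (s' aFound 0%N = 0 /\ s' aT 0%N = 2 ^+ i /\
       forall j, g j / 2 ^+ i.+1 \is a Num.int) \/ pivoted g s'])).
    apply: (@hoare_for b L b0 L0 [:: aP; aFound] cK _ _ s3 r n
      (fun k s' r' => r' = r /\ ((s' aFound 0%N = 0 /\ s' aT 0%N = 2 ^+ i /\
       (forall j, g j / 2 ^+ i \is a Num.int) /\
       forall j : 'I_n, (j < k)%N -> g j / 2 ^+ i.+1 \is a Num.int) \/ pivoted g s'))) => //.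
    + by move=> s' ag; rewrite eval_var //; have [] := g3 _ _ ag isT isT.
    + by split=> //; case: cas => [[? [? ?]]|?]; [left|right].
    + move=> k s4 r4 kn [-> cas4] ag4 s22.
      apply: (hoare_if L0); rewrite eval_var // => s8.
        apply: hoare_skip; split=> //; split=> //; right.
        by case: cas4 => // -[h]; rewrite h eqxx in s8.
      case: cas4 => [[_ [s6 [ci ck]]]|[h]]; last by move: s8; rewrite h => /eqP; rewrite oner_eq0.
      have [n4 g4] := g3 _ _ ag4 isT isT.
      have quot : ev s4 (EDiv (arr aG (var cK)) (EMul (Cst 2) (var aT))) = g (Ordinal kn) / 2 ^+ i.+1.
        rewrite !evE (eval_arr b0 (k := k)) ?eval_var // s6 exprS.
        by rewrite -(g4 (Ordinal kn)).
      apply: (hoare_if L0) => [/negP|/eqP]; rewrite eval_nint quot => hq.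
        apply: (hoare_seq (Q1 := fun s' r' => [/\ r' = r, agree [:: aP; aFound] s4 s' &
            s' aP 0%N = k%:R])).
          apply: (hoare_put b0 L0 (k := 0%N) (v := k%:R)) => //.
          - by rewrite eval_var.
          - by apply: bnd_natr; apply: leq_trans (leq_expn2 _) (leq_pow2 _); lia.
          - by split=> //; exact: agree_supd.
        move=> s5 r5 [-> ag5 s7].
        apply: (hoare_put b0 L0 (k := 0%N) (v := 1)) => //; first exact: bnd1.
        split; last by apply: agree_trans ag5 _; exact: agree_supd.
        split=> //; right; split=> //; exists (Ordinal kn), i; split=> //.
        + by rewrite /supd /= (ag5 aT _ isT).
        + apply: int_half => //; move/negP: hq; congr (~~ (_ \is a _)).
          by rewrite exprSr invfM mulrA.
      apply: hoare_skip; split=> //; split=> //; left; split=> //; split=> //.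
      split=> // j; rewrite ltnS leq_eqVlt => /orP[/eqP jk|]; last exact: ck.
      by have -> : j = Ordinal kn by apply/val_inj.
    + move=> s' r' [-> h] ag; split=> //; case: h => [[? [? [? h]]]|]; [left|by right].
      by split=> //; split=> // j; apply: h.
  move=> s4 r4 [-> ag4 cas4]; apply: (hoare_if L0); rewrite eval_var // => s8.
    apply: hoare_skip; split; first by split=> //; right; case: cas4 => // -[h]; rewrite h eqxx in s8.
    by apply: agree_sub ag4 => a; rewrite !inE => /or3P[] /eqP ->.
  case: cas4 => [[_ [s6 ci]]|[h]]; last by move: s8; rewrite h => /eqP; rewrite oner_eq0.
  apply: (hoare_put b0 L0 (k := 0%N) (v := 2 ^+ i.+1)) => //.
  + by rewrite !evE eval_var // s6 exprS.
  + by rewrite -natrX; apply: bnd_natr; apply: leq_pow2; lia.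
  + split; last first.
      apply: agree_trans; last exact: agree_supd.
      by apply: agree_sub ag4 => a; rewrite !inE => /or3P[] /eqP ->.
    by split=> //; left.
move=> s3 r3 [-> cas] ag3; split=> //.
  by apply: agree_trans ag2 _; apply: agree_sub ag3 => a; rewrite !inE => /or4P[|||/orP[]] /eqP ->.
case: cas => [[s8 [_ h]]|]; [left | by right].
(* A nonzero multiple of 2 ^ (n ^ 2 + 2) would exceed the bound on the row. *)
split=> // j; apply/eqP; apply: contraTT (h j) => gj0.
apply/negP => hi; have := norm_intr_ge1 hi.
rewrite mulf_neq0 ?invr_neq0 ?expf_neq0 // => /(_ isT).
rewrite leNgt => /negP; apply; rewrite normrM normfV normrX normr_nat.
rewrite ltr_pdivrMr ?exprn_gt0 // mul1r; apply: le_lt_trans (gL j) _.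
rewrite -natrX ltr_nat expnD mulnC.
apply: (@leq_ltn_trans (2 ^ (n * n) * 3)%N); first by rewrite leq_mul2r fact_le orbT.
by rewrite ltn_mul2l expn_gt0.
Qed.


Lemma bnd_fact (q : rat) : q \is a Num.int -> `|q| <= n`!%:R -> bnd L q.
Proof.
move=> iq h; apply: bnd_int => //; apply: le_trans h _; rewrite ler_nat.
by apply: leq_trans factL; rewrite leq_pmull.
Qed.

Lemma update_spec s r C E Fs (f : 'rV[rat]_n) :
  holds s C E -> reduced Fs C E -> is01 f ->
  (forall j : 'I_n, s aG j = (f *m C) 0 j) ->
  (s aFound 0%N = 0 /\ forall j, (f *m C) 0 j = 0) \/ pivoted (fun j => (f *m C) 0 j) s ->
  hoare b L update_prog s r (fun s' r' =>
    [/\ r' = r, agree [:: aE; aC; aCol; aLead; cJ; cK] s s' &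
     exists C' E', holds s' C' E' /\ reduced (addF Fs f) C' E']).
Proof.
move=> hS red f01 hg cas; have [hn hE hC] := hS.
apply: (hoare_if L0); rewrite eval_var // => s8; last first.
  case: cas => [[_ g0]|[h]]; last by move: s8; rewrite h => /eqP; rewrite oner_eq0.
  apply: hoare_skip; split=> //; exists C, E; split=> //.
  by apply: reduced_skip => //; apply/rowP => j; rewrite g0 mxE.
case: cas => [[h]|[_ [p [k [s7 s6 ig og]]]]]; first by rewrite h eqxx in s8.
have red' := reduced_pivot f01 red ig og.
set g := (f *m C) 0 in hg ig og red' *.
pose C' := pivot C E f p (2 ^+ k); rewrite -/C' in red'.
apply: (hoare_seq (Q1 := fun s' r' => [/\ r' = r, agree [:: cJ; aCol] s s' &
    forall x : 'I_n, s' aCol x = C x p])).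
  apply: (@hoare_for b L b0 L0 [:: aCol] cJ _ _ s r n
   (fun i s' r' => r' = r /\ forall x : 'I_n, (x < i)%N -> s' aCol x = C x p)) => //.
  - by move=> s' ag; rewrite eval_var // (ag aN _ isT).
  - move=> i s' r' iN [-> hi] ag s21.
    apply: (hoare_put b0 L0 (k := i) (v := C (Ordinal iN) p)) => //.
    + by rewrite eval_var.
    + rewrite (eval_arr b0 (k := (i * n + p)%N)) //.
        by rewrite (ag aC _ isT) -hC.
      by apply: eval_idx; rewrite ?eval_var // ?(ag aN _ isT) // (ag aP _ isT).
    + by apply: bnd_fact; [exact: (red_int red) | exact: reduced_le red].
    + split; last exact: agree_supd.
      split=> // x; rewrite ltnS leq_eqVlt /supd /=.
      case: (@eqnP x i) => [xi _ /=|/eqP xi /=]; last by rewrite (negbTE xi) /=; apply: hi.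
      by congr (C _ _); apply/val_inj.
  - by move=> s' r' [-> h] ag; split=> // x; apply: h.
move=> s1 r1 [-> ag1 h9].
apply: (hoare_seq (Q1 := fun s' r' => [/\ r' = r, agree [:: cJ; aCol; aLead] s s',
    forall x : 'I_n, s' aCol x = C x p & s' aLead 0%N = g p / 2 ^+ k])).
  apply: (hoare_put b0 L0 (k := 0%N) (v := g p / 2 ^+ k)) => //.
  - rewrite !evE eval_var // (ag1 aT _ isT) s6 (eval_arr b0 (k := p)) //.
      by rewrite (ag1 aG _ isT) hg.
    by rewrite eval_var // (ag1 aP _ isT).
  - by apply: bnd_fact => //; exact: reduced_E_le red'.
  - split=> //; apply: agree_trans; last exact: agree_supd.
    by apply: agree_sub ag1 => a; rewrite !inE => /orP[] /eqP ->.
move=> {h9 ag1 s1 r1} s1 r1 [-> ag1 h9 h10].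
have read1 (s2 : store) : agree [:: cJ; cK; aC] s1 s2 ->
    [/\ s2 aN 0%N = n%:R, s2 aE 0%N = E, forall j : 'I_n, s2 aG j = g j,
        s2 aT 0%N = 2 ^+ k & (forall x : 'I_n, s2 aCol x = C x p) /\
        s2 aLead 0%N = g p / 2 ^+ k].
  move=> ag; split.
  - by rewrite (ag aN _ isT) (ag1 aN _ isT).
  - by rewrite (ag aE _ isT) (ag1 aE _ isT).
  - by move=> j; rewrite (ag aG _ isT) (ag1 aG _ isT).
  - by rewrite (ag aT _ isT) (ag1 aT _ isT).
  - by split; [move=> x|]; rewrite ag.
apply: (hoare_seq (Q1 := fun s' r' => [/\ r' = r, agree [:: cJ; cK; aC] s1 s' &
    forall x j : 'I_n, s' aC (x * n + j)%N = C' x j])).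
  apply: (@hoare_for b L b0 L0 [:: cK; aC] cJ _ _ s1 r n
   (fun i s' r' => r' = r /\ forall x j : 'I_n, s' aC (x * n + j)%N =
        if (x < i)%N then C' x j else C x j)) => //.
  - by move=> s' /read1[h1 _ _ _ _]; rewrite eval_var.
  - by split=> // x j; rewrite ltn0 (ag1 aC _ isT).
  - move=> i s2 r2 iN [-> hi] ag2 s21.
    apply: (@hoare_for b L b0 L0 [:: aC] cK _ _ s2 r n
     (fun l s' r' => r' = r /\ forall x j : 'I_n, s' aC (x * n + j)%N =
        if (x < i)%N || (val x == i) && (j < l)%N then C' x j else C x j)) => //.
    + move=> s' ag; have [h1 _ _ _ _] := read1 _ ag2.
      by rewrite eval_var // (ag aN _ isT).
    + by split=> // x j; rewrite ltn0 andbF orbF.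
    + move=> l s3 r3 lN [-> hl] ag3 s22.
      have ag23 : agree [:: cJ; cK; aC] s1 s3 by apply: agree_trans ag2 _;
        apply: agree_sub ag3 => a; rewrite !inE => /orP[] /eqP ->.
      have [h1 h3 h5 h6 [h9' h10']] := read1 _ ag23.
      have s21' : s3 cJ 0%N = i%:R by rewrite (ag3 cJ _ isT).
      have ei : ev s3 (idx (var cJ) (var cK)) = (i * n + l)%N%:R.
        by apply: eval_idx; rewrite ?eval_var.
      apply: (hoare_put b0 L0 (k := (i * n + l)%N) (v := C' (Ordinal iN) (Ordinal lN))) => //.
      * rewrite !evE !eval_var // h10' h3 h6 (eval_arr b0 _ ei) //.
        rewrite (eval_arr b0 (k := i)) ?eval_var // (eval_arr b0 (k := l)) ?eval_var //.
        rewrite (h9' (Ordinal iN)) (h5 (Ordinal lN)).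
        rewrite (hl (Ordinal iN) (Ordinal lN)) /= !ltnn andbF /=.
        by rewrite /C' /pivot mxE.
      * by apply: bnd_fact; [exact: (red_int red') | exact: reduced_le red'].
      * split; last exact: agree_supd.
        split=> // x j; rewrite /supd /= eqnE idx_inj // hl ltnS [(j <= l)%N]leq_eqVlt.
        have -> : (val x == i) = (x == Ordinal iN) by [].
        case: (eqVneq x (Ordinal iN)) => [->|] /=; last by rewrite orbF.
        case: (eqVneq (val j) l) => [jl|] //=; rewrite ltnn /=.
        by congr (C' _ _); apply/val_inj.
    + move=> s' r' [-> h] ag; split=> //; split=> // x j; rewrite h ltn_ord andbT.
      by rewrite ltnS [(x <= i)%N]leq_eqVlt orbC.
  - by move=> s' r' [-> h] ag; split=> // x j; rewrite h ltn_ord.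
move=> s2 r2 [-> ag2 hC']; have [h1 _ _ _ [_ h10']] := read1 _ ag2.
apply: (hoare_put b0 L0 (k := 0%N) (v := g p / 2 ^+ k)) => //.
- by rewrite eval_var.
- by apply: bnd_fact => //; exact: reduced_E_le red'.
split=> //.
  apply: agree_trans; last exact: agree_supd.
  apply: agree_trans (agree_sub _ ag1) (agree_sub _ ag2) => a;
    by rewrite !inE => /or3P[] /eqP ->.
by exists C', (g p / 2 ^+ k); split.
Qed.

Lemma init_spec s r :
  s aN 0%N = n%:R -> (forall k, s aC k = 0) ->
  hoare b L init_prog s r (fun s' r' =>
    [/\ r' = r, agree [:: aE; aC; cJ] s s' & holds s' 1%:M 1]).
Proof.
move=> hn h4.
apply: (hoare_seq (Q1 := fun s' r' => [/\ r' = r, agree [:: aE] s s' & s' aE 0%N = 1])).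
  apply: (hoare_put b0 L0 (k := 0%N) (v := 1)) => //; first exact: bnd1.
  by split=> //; exact: agree_supd.
move=> s1 r1 [-> ag1 h3].
apply: (@hoare_for b L b0 L0 [:: aC] cJ _ _ s1 r n
   (fun i s' r' => r' = r /\ forall x j : 'I_n, s' aC (x * n + j)%N =
        ((x < i)%N && (x == j))%:R)) => //.
- by move=> s' ag; rewrite eval_var // (ag aN _ isT) (ag1 aN _ isT).
- by split=> // x j; rewrite ltn0 (ag1 aC _ isT) h4.
- move=> i s2 r2 iN [-> hi] ag2 s21.
  apply: (hoare_put b0 L0 (k := (i * n + i)%N) (v := 1)) => //.
  + by apply: eval_idx; rewrite ?eval_var // (ag2 aN _ isT) (ag1 aN _ isT).
  + exact: bnd1.
  + split; last exact: agree_supd.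
    split=> // x j; rewrite /supd /= eqnE idx_inj // hi ltnS [(x <= i)%N]leq_eqVlt.
    case: (eqVneq (val x) i) => [xi|] //=; rewrite xi ltnn /= -val_eqE /= xi eq_sym.
    by case: eqP.
- move=> s' r' [-> h] ag; split=> //.
    apply: agree_trans (agree_sub _ ag1) (agree_sub _ ag) => a; rewrite !inE.
      by move=> /eqP ->.
    by move=> /orP[] /eqP ->.
  split; [by rewrite (ag aN _ isT) (ag1 aN _ isT)| by rewrite (ag aE _ isT) |].
  by move=> x j; rewrite h ltn_ord mxE.
Qed.

Lemma reduced_ext (Fs Fs' : 'rV[rat]_n -> Prop) C E :
  (forall f, Fs f <-> Fs' f) -> reduced Fs C E -> reduced Fs' C E.
Proof.
move=> h [h1 h2 h3 h4 h5]; split=> // [f /h /h3 //|u hu].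
by apply: h4 => f /h; apply: hu.
Qed.

Definition first_edges (H : hypergraph 'I_n) (i : nat) : 'rV[rat]_n -> Prop :=
  fun f => exists2 k, (k < i)%N & f = edge_row (nth finset.set0 (enum H) k).

Lemma elim_spec (H : hypergraph 'I_n) s r : uniform3 H ->
  s aN 0%N = n%:R -> s aM 0%N = #|H|%:R -> (forall k, s aC k = 0) ->
  (#|H| <= L)%N -> (3 * #|H| + 2 <= b)%N ->
  (forall e x y z, (e < #|H|)%N -> enum (nth finset.set0 (enum H) e) = [:: x; y; z] ->
     [/\ s LOW (3 * e + 2)%N = x%:R, s LOW (3 * e + 3)%N = y%:R
       & s LOW (3 * e + 4)%N = z%:R]) ->
  hoare b L elim_prog s r (fun s' r' =>
    [/\ r' = r, agree [:: aE; aC; aG; aT; aP; aFound; aCol; aLead; cI; cJ; cK] s s' &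
     exists C E, holds s' C E /\ reduced (edges H) C E]).
Proof.
move=> H3 hn hm h4 mL mb hin.
apply: (hoare_seq (init_spec r hn h4)) => s1 r1 [-> ag1 hold1].
apply: (@hoare_for b L b0 L0 [:: aE; aC; aG; aT; aP; aFound; aCol; aLead; cJ; cK] cI _ _ s1 r #|H|
   (fun i s' r' => r' = r /\ exists C E, holds s' C E /\ reduced (first_edges H i) C E)) => //.
- by move=> s' ag; rewrite eval_var // (ag aM _ isT) (ag1 aM _ isT).
- split=> //; exists 1%:M, 1; split=> //.
  by apply: reduced_ext (reduced0 n) => f; split=> // -[].
- move=> i s2 r2 iH [-> [C [E [hS red]]]] ag2 s20.
  pose e := nth finset.set0 (enum H) i.
  have eH : e \in H by rewrite -mem_enum mem_nth // -cardE.
  have [x [y [z en]]] := enum3 (H3 e eH).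
  have [hx hy hz] := hin i x y z iH en.
  have low k : s2 LOW k = s LOW k by rewrite (ag2 LOW _ isT) (ag1 LOW _ isT).
  have ib : (3 * i + 4 < b)%N by lia.
  apply: (hoare_seq (@row_spec s2 r C E i x y z _ hS red s20 ib _ _ _)); rewrite ?low //.
  move=> s3 r3 [-> ag3 h5].
  have gE j : C x j + C y j + C z j = (edge_row e *m C) 0 j.
    by rewrite edge_rowM -big_enum en !big_cons big_nil /= addr0 addrA.
  have hS3 : holds s3 C E by apply: holds_agree ag3 hS.
  have [h1 _ _] := hS3.
  apply: (hoare_seq (@search_spec s3 r (fun j => (edge_row e *m C) 0 j) h1 _ _ _)).
  + by move=> j; rewrite h5 gE.
  + by move=> j; rewrite -gE !rpredD // (red_int red).
  + by move=> j; rewrite -gE; exact: reduced_sum3_le red.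
  move=> s4 r4 [-> ag4 cas].
  have hS4 : holds s4 C E by apply: holds_agree ag4 hS3.
  apply: (hoare_conseq (@update_spec s4 r C E _ (edge_row e) hS4 red _ _ cas)).
  + exact: edge_row01.
  + by move=> j; rewrite (ag4 aG _ isT) h5 gE.
  move=> s5 r5 [-> ag5 [C' [E' [hS5 red5]]]]; split.
    split=> //; exists C', E'; split=> //; apply: reduced_ext red5 => f; split.
      case=> [[k ki ->]|->]; first by exists k => //; rewrite ltnW.
      by exists i.
    case=> k; rewrite ltnS leq_eqVlt => /orP[/eqP ->|ki] ->; [by right|left].
    by exists k.
  apply: agree_trans (agree_sub _ ag3) (agree_trans (agree_sub _ ag4) (agree_sub _ ag5)) => a;
    by rewrite !inE; repeat (case/orP; [by move/eqP->|]); move/eqP->.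
move=> s' r' [-> [C [E [hS red]]]] ag; split=> //.
  apply: agree_trans (agree_sub _ ag1) (agree_sub _ ag) => a;
    by rewrite !inE; repeat (case/orP; [by move/eqP->|]); move/eqP->.
exists C, E; split=> //; apply: reduced_ext red => f; split.
  by case=> k kH ->; exists (nth finset.set0 (enum H) k) => //; rewrite -mem_enum mem_nth // -cardE.
case=> e eH ->; exists (index e (enum H)); first by rewrite cardE index_mem mem_enum.
by rewrite nth_index // mem_enum.
Qed.

End Specs.

(** * Program for the random combination *)

Definition coef_prog :=
  Seq (put aCoef (Cst 0) (Cst 0)) (Seq (put aWt (Cst 0) (Cst 1))
  (For cJ (var aN)
    (Seq (Flip (adr aBit (Cst 0)))
    (Seq (put aCoef (Cst 0) (EAdd (var aCoef) (EMul (var aBit) (var aWt))))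
         (put aWt (Cst 0) (EMul (Cst 2) (var aWt))))))).

Definition add_prog :=
  For cJ (var aN) (put aSol (var cJ)
    (EAdd (arr aSol (var cJ)) (EMul (var aCoef) (arr aC (idx (var cJ) (var cI)))))).

Definition comb_prog := For cI (var aN) (Seq coef_prog add_prog).

Definition output_prog :=
  For cI (var aN) (Write (EAdd (var cI) (Cst 1)) (arr aSol (var cI))).

Definition coefp n (r : seq bool) (j k : nat) : rat :=
  \sum_(i < k) (nth false r (j * n + i))%:R * 2 ^+ i.

Lemma coefpS n r j k :
  coefp n r j k.+1 = coefp n r j k + (nth false r (j * n + k))%:R * 2 ^+ k.
Proof. by rewrite /coefp big_ord_recr. Qed.

Lemma coefp_int n r j k : coefp n r j k \is a Num.int.
Proof.
apply: rpred_sum => i _; apply: rpredM; last by rewrite rpredX // (rpred_nat _ 2).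
by case: (nth _ _ _).
Qed.

Lemma coefp_bounds n r j k : 0 <= coefp n r j k <= 2 ^+ k - 1.
Proof.
elim: k => [|k /andP[h1 h2]]; first by rewrite /coefp big_ord0 expr0 subrr lexx.
rewrite coefpS exprS; have t0 : (0 : rat) < 2 ^+ k by rewrite exprn_gt0.
by case: (nth _ _ _); rewrite ?mul1r ?mul0r; apply/andP; split; lra.
Qed.

Lemma sum_ltS n (F : 'I_n -> rat) j (jn : (j < n)%N) :
  \sum_(i < n | (i < j.+1)%N) F i = \sum_(i < n | (i < j)%N) F i + F (Ordinal jn).
Proof.
rewrite (bigD1 (Ordinal jn)) //= addrC; congr (_ + _); apply: eq_bigl => i.
by rewrite ltnS -val_eqE /= [RHS]ltn_neqAle andbC.
Qed.

Section Specs.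

Variables (n b L : nat).
Hypothesis (b0 : (0 < b)%N).
Hypothesis (nL : (n * n + 2 * n + 2 <= L)%N).

Notation ev s e := (eval (lay b s) e).

Let L0 : (0 < L)%N. Proof. by apply: leq_trans nL; rewrite addn2. Qed.
Let nL1 : (n <= L)%N. Proof. by apply: leq_trans nL; lia. Qed.

Lemma coef_spec s r r0 (j : nat) :
  s aN 0%N = n%:R -> r = drop (j * n) r0 -> (j.+1 * n <= size r0)%N ->
  hoare b L coef_prog s r (fun s' r' =>
    [/\ r' = drop (j.+1 * n) r0, agree [:: aCoef; aBit; aWt; cJ] s s' &
        s' aCoef 0%N = coef n r0 j]).
Proof.
move=> hn -> jr.
apply: (hoare_seq (Q1 := fun s' r' => [/\ r' = drop (j * n) r0, agree [:: aCoef] s s' & s' aCoef 0%N = 0])).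
  apply: (hoare_put b0 L0 (k := 0%N) (v := 0)) => //; first exact: bnd0.
  by split=> //; exact: agree_supd.
move=> s1 r1 [-> ag1 h11].
apply: (hoare_seq (Q1 := fun s' r' => [/\ r' = drop (j * n) r0, agree [:: aCoef; aWt] s s',
   s' aCoef 0%N = 0 & s' aWt 0%N = 1])).
  apply: (hoare_put b0 L0 (k := 0%N) (v := 1)) => //; first exact: bnd1.
  split=> //; apply: agree_trans; last exact: agree_supd.
  by apply: agree_sub ag1 => a; rewrite !inE => /eqP ->.
move=> {s1 ag1 h11 r1} s1 r1 [-> ag1 h11 h13].
apply: (@hoare_for b L b0 L0 [:: aCoef; aBit; aWt] cJ _ _ s1 _ n
   (fun k s' r' => [/\ r' = drop (j * n + k) r0, s' aCoef 0%N = coefp n r0 j k &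
      s' aWt 0%N = 2 ^+ k])) => //.
- by move=> s' ag; rewrite eval_var // (ag aN _ isT) (ag1 aN _ isT).
- by split; rewrite ?addn0 // h11 /coefp big_ord0.
- move=> k s2 r2 kn [-> h11' h13'] ag2 s21.
  rewrite (drop_nth false); last by apply: leq_trans jr; rewrite mulSn addnC ltn_add2r.
  set x := nth _ _ _.
  apply: (hoare_seq (Q1 := fun s' r' => [/\ r' = drop (j * n + k).+1 r0,
      agree [:: aBit] s2 s' & s' aBit 0%N = x%:R])).
    by apply: (hoare_flip b0 L0) => //; split=> //; exact: agree_supd.
  move=> s3 r3 [-> ag3 h12].
  apply: (hoare_seq (Q1 := fun s' r' => [/\ r' = drop (j * n + k).+1 r0,
      agree [:: aCoef; aBit] s2 s' & s' aCoef 0%N = coefp n r0 j k.+1])).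
    apply: (hoare_put b0 L0 (k := 0%N) (v := coefp n r0 j k.+1)) => //.
    + rewrite !evE !eval_var // h12 (ag3 aCoef _ isT) (ag3 aWt _ isT) h11' h13'.
      by rewrite coefpS.
    + apply: bnd_int; first exact: coefp_int.
      have /andP[h1 h2] := coefp_bounds n r0 j k.+1.
      rewrite ger0_norm // natrX; apply: le_trans h2 _.
      rewrite lerBlDr; apply: ler_wpDr => //.
      by rewrite ler_weXn2l // ?ler1n //; apply: leq_trans kn nL1.
    + split=> //; apply: agree_trans; last exact: agree_supd.
      by apply: agree_sub ag3 => a; rewrite !inE => /eqP ->.
  move=> s4 r4 [-> ag4 h11''].
  apply: (hoare_put b0 L0 (k := 0%N) (v := 2 ^+ k.+1)) => //.
  + by rewrite !evE eval_var // (ag4 aWt _ isT) h13' exprS.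
  + by rewrite -natrX; apply: bnd_natr; apply: leq_pow2; apply: leq_trans kn nL1.
  + split; first by split; rewrite ?addnS.
    apply: agree_trans; last exact: agree_supd.
    by apply: agree_sub ag4 => a; rewrite !inE => /orP[] /eqP ->.
- move=> s' r' [-> h11' _] ag; split=> //; first by rewrite mulSn addnC.
  apply: agree_trans (agree_sub _ ag1) (agree_sub _ ag) => a;
    by rewrite !inE; repeat (case/orP; [by move/eqP->|]); move/eqP->.
Qed.

Definition pcomb (C : 'M[rat]_n) (r : seq bool) (j : nat) (x : 'I_n) : rat :=
  \sum_(i < n | (i < j)%N) coef n r i * C x i.

Lemma pcomb_bnd Fs C E r j x : reduced Fs C E -> bnd L (pcomb C r j x).
Proof.
move=> red; apply: bnd_int.
  by apply: rpred_sum => i _; apply: rpredM; [exact: coefp_int | exact: (red_int red)].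
apply: le_trans (_ : (n * (2 ^ n * n`!))%N%:R <= _); last first.
  rewrite ler_nat; apply: (@leq_trans (2 ^ n * (2 ^ n * 2 ^ (n * n)))%N).
    by rewrite leq_mul ?leq_expn2 // leq_mul // fact_le.
  by rewrite -!expnD leq_pow2 //; lia.
apply: le_trans (ler_norm_sum _ _ _) _.
apply: le_trans (_ : \sum_(i < n) (2 ^ n * n`!)%N%:R <= _); last first.
  by rewrite sumr_const card_ord (natrM _ n) mulr_natl.
rewrite big_mkcond; apply: ler_sum => i _; case: ifP => _ //.
rewrite normrM natrM ler_pM // ?(reduced_le _ _ red) // natrX.
have /andP[h1 h2] := coefp_bounds n r i n; rewrite ger0_norm //.
by apply: le_trans h2 _; rewrite lerBlDr lerDl.
Qed.

Lemma comb_spec s r C E Fs :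
  holds s C E -> reduced Fs C E -> (forall k, s aSol k = 0) ->
  (n * n <= size r)%N ->
  hoare b L comb_prog s r (fun s' r' =>
    s' aN 0%N = n%:R /\ forall x : 'I_n, s' aSol x = comb (C x) r).
Proof.
move=> hS red h14 nr; have [hn _ hC] := hS.
apply: (@hoare_for b L b0 L0 [:: aCoef; aBit; aWt; aSol; cJ] cI _ _ s r n
   (fun j s' r' => r' = drop (j * n) r /\ forall x : 'I_n, s' aSol x = pcomb C r j x)) => //.
- by move=> s' ag; rewrite eval_var // (ag aN _ isT).
- by split; rewrite ?mul0n ?drop0 // => x; rewrite h14 /pcomb big1.
- move=> j s1 r1 jn [-> hv] ag1 s20.
  have hn1 : s1 aN 0%N = n%:R by rewrite (ag1 aN _ isT).
  apply: (hoare_seq (@coef_spec s1 _ r j hn1 erefl _)).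
    by apply: leq_trans nr; rewrite leq_mul2r jn orbT.
  move=> s2 r2 [-> ag2 h11].
  apply: (@hoare_for b L b0 L0 [:: aSol] cJ _ _ s2 _ n
   (fun k s' r' => r' = drop (j.+1 * n) r /\
      forall x : 'I_n, s' aSol x = pcomb C r (if (x < k)%N then j.+1 else j) x)) => //.
  + by move=> s' ag; rewrite eval_var // (ag aN _ isT) (ag2 aN _ isT).
  + by split=> // x; rewrite ltn0 (ag2 aSol _ isT).
  + move=> k s3 r3 kn [-> hk] ag3 s21.
    have [h1 h20] : s3 aN 0%N = n%:R /\ s3 cI 0%N = j%:R.
      by rewrite (ag3 aN _ isT) (ag2 aN _ isT) (ag3 cI _ isT) (ag2 cI _ isT).
    apply: (hoare_put b0 L0 (k := k) (v := pcomb C r j.+1 (Ordinal kn))) => //.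
    * by rewrite eval_var.
    * rewrite !evE (eval_arr b0 (k := k)) ?eval_var //.
      rewrite (eval_arr b0 (k := (k * n + j)%N)) //; last first.
        by apply: eval_idx; rewrite ?eval_var.
      rewrite (hk (Ordinal kn)) /= ltnn (ag3 aCoef _ isT) h11.
      rewrite (ag3 aC _ isT) (ag2 aC _ isT) (ag1 aC _ isT).
      by rewrite /pcomb (sum_ltS _ jn) (hC (Ordinal kn) (Ordinal jn)).
    * exact: pcomb_bnd red.
    * split; last exact: agree_supd.
      split=> // x; rewrite /supd /= eqnE ltnS [(x <= k)%N]leq_eqVlt.
      case: (eqVneq (val x) k) => [xk|] /=; last by rewrite hk.
      by congr (pcomb _ _ _ _); apply/val_inj.
  + move=> s' r' [-> hk] ag; split; first by split=> // x; rewrite hk ltn_ord.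
    apply: agree_trans (agree_sub _ ag2) (agree_sub _ ag) => a;
      by rewrite !inE; repeat (case/orP; [by move/eqP->|]); move/eqP->.
- move=> s' r' [_ h] ag; split; first by rewrite (ag aN _ isT).
  by move=> x; rewrite h /pcomb /comb; apply: eq_bigl => i; rewrite ltn_ord.
Qed.

Lemma output_spec s r (v : 'I_n -> rat) :
  (n < b)%N -> s aN 0%N = n%:R -> (forall x : 'I_n, s aSol x = v x) ->
  (forall k, bnd L (s aSol k)) ->
  hoare b L output_prog s r (fun s' r' => forall x : 'I_n, s' LOW x.+1 = v x).
Proof.
move=> nb hn hv bv.
apply: (@hoare_for b L b0 L0 [:: LOW] cI _ _ s r n
   (fun j s' r' => forall x : 'I_n, (x < j)%N -> s' LOW x.+1 = v x)) => //.
- by move=> s' ag; rewrite eval_var // (ag aN _ isT).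
- move=> j s' r' jn hj ag s20.
  apply: (hoare_put_low L0 (k := j.+1) (v := v (Ordinal jn))) => //.
  + by lia.
  + by rewrite !evE eval_var // s20 -natrD addn1.
  + by rewrite (eval_arr b0 (k := j)) ?eval_var // (ag aSol _ isT) -hv.
  + by rewrite -hv.
  + split; last exact: agree_supd.
    move=> x; rewrite ltnS leq_eqVlt /supd /= eqnE.
    case: (eqVneq (val x) j) => [xj _ /=|xj /=]; last exact: hj.
    by congr v; apply/val_inj.
- by move=> s' r' h _ x; apply: h.
Qed.

End Specs.

(** * Rounding *)

Notation rX := 2%N (only parsing).
Notation rExp := 3%N (only parsing).

(** Every entry is tested [n] times for divisibility by 2.  This bounds the
    running time also for a zero entry, and suffices to find any exponent below
    [n]. *)
Definition round_prog :=
  For cI (var aN)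
    (Seq (put rX (Cst 0) (Read (EAdd (var cI) (Cst 1))))
    (Seq (put rExp (Cst 0) (Cst 0))
    (Seq (For cJ (var aN)
           (If (nint (EDiv (var rX) (Cst 2))) Skip
               (Seq (put rX (Cst 0) (EDiv (var rX) (Cst 2)))
                    (put rExp (Cst 0) (EAdd (var rExp) (Cst 1))))))
         (Write (EAdd (var cI) (Cst 1)) (var rExp))))).

Definition capped_val (n : nat) (v w : rat) := exists (c : nat) y,
  [/\ w = c%:R, v = y * 2 ^+ c, y \is a Num.int, (c <= n)%N & c = n \/ oddq y].

Lemma round_spec n L b (v : 'I_n -> rat) s r : (0 < L)%N -> (n <= L)%N ->
  (n < b)%N -> s aN 0%N = n%:R ->
  (forall x : 'I_n, s LOW x.+1 = v x) -> (forall x, v x \is a Num.int) ->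
  (forall x, bnd L (v x)) ->
  hoare b L round_prog s r (fun s' r' => forall x : 'I_n, capped_val n (v x) (s' LOW x.+1)).
Proof.
move=> L0 nL nb hn hv iv bv; have b0 : (0 < b)%N by apply: leq_ltn_trans nb.
apply: (@hoare_for b L b0 L0 [:: rX; rExp; cJ; LOW] cI _ _ s r n
   (fun j s' r' => forall x : 'I_n,
     if (x < j)%N then capped_val n (v x) (s' LOW x.+1) else s' LOW x.+1 = v x)) => //.
- by move=> s' ag; rewrite eval_var // (ag aN _ isT).
- move=> j s1 r1 jn hj ag1 s20; pose x := Ordinal jn.
  have hn1 : s1 aN 0%N = n%:R by rewrite (ag1 aN _ isT).
  have lo s' : s' cI 0%N = j%:R -> eval (lay b s') (EAdd (var cI) (Cst 1)) = j.+1%:R.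
    by move=> h; rewrite !evE eval_var // h -natrD addn1.
  have jb : (0 < j.+1 < b)%N by rewrite /=; apply: leq_ltn_trans nb.
  apply: (hoare_seq (Q1 := fun s' r' => agree [:: rX] s1 s' /\ s' rX 0%N = v x)).
    apply: (hoare_put b0 L0 (k := 0%N) (v := v x)) => //; last by split=> //; exact: agree_supd.
    by rewrite (eval_low (lo _ s20) jb); have := hj x; rewrite /= ltnn.
  move=> s2 r2 [ag2 h2].
  apply: (hoare_seq (Q1 := fun s' r' => [/\ agree [:: rX; rExp] s1 s', s' rX 0%N = v x
      & s' rExp 0%N = 0])).
    apply: (hoare_put b0 L0 (k := 0%N) (v := 0)) => //; first exact: bnd0.
    split=> //; apply: agree_trans; last exact: agree_supd.
    by apply: agree_sub ag2 => a; rewrite !inE => /eqP ->.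
  move=> {s2 r2 ag2 h2} s2 r2 [ag2 h2 h3].
  apply: (hoare_seq (Q1 := fun s' r' => agree [:: rX; rExp; cJ] s1 s' /\
      capped_val n (v x) (s' rExp 0%N))).
    apply: (@hoare_for b L b0 L0 [:: rX; rExp] cJ _ _ s2 r2 n
      (fun k s' r' => exists (c : nat) y, [/\ s' rX 0%N = y, s' rExp 0%N = c%:R, v x = y * 2 ^+ c &
         [/\ y \is a Num.int, (c <= k)%N & c = k \/ oddq y]])) => //.
    + by move=> s' ag; rewrite eval_var // (ag aN _ isT) (ag2 aN _ isT).
    + by exists 0%N, (v x); split=> //; [rewrite mulr1 | split=> //; left].
    + move=> k s3 r3 kn [c [y [h2' h3' vy [iy ck oy]]]] ag3 s21.
      apply: (hoare_if L0) => [/negP|/eqP]; rewrite eval_nint !evE eval_var // h2' => hy.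
        apply: hoare_skip; split=> //; exists c, y; split=> //; split=> //; first exact: leqW.
        by right; apply: int_half => //; apply/negP.
      have {}oy : c = k by case: oy => // /oddq_nhalf; rewrite hy.
      apply: (hoare_seq (Q1 := fun s' r' => agree [:: rX] s3 s' /\ s' rX 0%N = y / 2)).
        apply: (hoare_put b0 L0 (k := 0%N) (v := y / 2)) => //.
        * by rewrite !evE eval_var // h2'.
        * apply: bnd_int => //; apply: le_trans (int_bnd (iv x) (bv x)).
          rewrite vy !normrM ler_wpM2l // normrX normr_nat.
          rewrite normfV normr_nat; apply: (@le_trans _ _ 1); first by lra.
          by rewrite exprn_ege1 // ler1n.
        * by split=> //; exact: agree_supd.
      move=> s4 r4 [ag4 h2''].
      apply: (hoare_put b0 L0 (k := 0%N) (v := c.+1%:R)) => //.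
      * by rewrite !evE eval_var // (ag4 rExp _ isT) h3' -natrD addn1.
      * apply: bnd_natr; apply: leq_trans (leq_expn2 _) (leq_pow2 _).
        by rewrite oy; apply: leq_trans kn nL.
      * split; last first.
          apply: agree_trans; last exact: agree_supd.
          by apply: agree_sub ag4 => a; rewrite !inE => /eqP ->.
        exists c.+1, (y / 2); split=> //; first by rewrite vy exprS mulrA divfK.
        by split=> //; left; rewrite oy.
    + move=> s' r' [c [y [_ h3' vy [iy ck oy]]]] ag; split; last first.
        by exists c, y; split.
      apply: agree_trans (agree_sub _ ag2) (agree_sub _ ag) => a;
        by rewrite !inE; repeat (case/orP; [by move/eqP->|]); move/eqP->.
  move=> s3 r3 [ag3 cv].
  apply: (hoare_put_low L0 (k := j.+1) (v := s3 rExp 0%N)) => //.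
  + by apply: lo; rewrite (ag3 cI _ isT).
  + by rewrite eval_var.
  + have [c [y [-> _ _ cn _]]] := cv.
    by apply: bnd_natr; apply: leq_trans (leq_expn2 _) (leq_pow2 _); apply: leq_trans cn nL.
  + split; last first.
      apply: agree_trans; last exact: agree_supd.
      apply: agree_sub ag3 => a;
        by rewrite !inE; repeat (case/orP; [by move/eqP->|]); move/eqP->.
    move=> y; rewrite /supd /= eqnE ltnS leq_eqVlt.
    have := hj y; rewrite (ag3 LOW _ isT).
    case: (eqVneq (val y) j) => [yj _|yj] /=.
      by have -> : y = x by apply/val_inj.
    by [].
- by move=> s' r' h _ x; have := h x; rewrite ltn_ord.
Qed.

(** * Input and output *)

Lemma nth_flatten_const (T : Type) (x0 : T) (ss : seq (seq T)) q e k :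
  (forall s, List.In s ss -> size s = q) -> (k < q)%N -> (e < size ss)%N ->
  nth x0 (flatten ss) (q * e + k) = nth x0 (nth [::] ss e) k.
Proof.
elim: ss e => [|s ss ih] [|e] //= hs kq es; rewrite nth_cat hs; try by left.
  by rewrite muln0 add0n kq.
rewrite mulnS -addnA ltnNge leq_addr /= addKn ih // => s' h.
by apply: hs; right.
Qed.

Lemma size_flatten_const (T : Type) (ss : seq (seq T)) q :
  (forall s, List.In s ss -> size s = q) -> size (flatten ss) = (q * size ss)%N.
Proof.
elim: ss => [|s ss ih] hs; first by rewrite muln0.
rewrite /= size_cat hs; last by left.
by rewrite ih ?mulnS // => s' h; apply: hs; right.
Qed.

Section Code.

Variables (n : nat) (H : hypergraph 'I_n).
Hypothesis H3 : uniform3 H.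

Let rows := [seq [seq (nat_of_ord x)%:R | x <- enum (e : {set 'I_n})] | e <- enum H] : seq (seq rat).

Let rows3 s : List.In s rows -> size s = 3%N.
Proof.
rewrite /rows; have : {subset enum H <= H} by move=> e; rewrite mem_enum.
elim: (enum H) => [//|e es ih] /= sub [<-|].
  by rewrite size_map -cardE H3 // sub // inE eqxx.
by apply: ih => e' h; apply: sub; rewrite inE h orbT.
Qed.

Lemma size_code : size (hypergraph_code H) = (3 * #|H| + 2)%N.
Proof.
by rewrite /= (size_flatten_const rows3) size_map -cardE addn2.
Qed.

Lemma nth_code e x y z : (e < #|H|)%N ->
  enum (nth finset.set0 (enum H) e) = [:: x; y; z] ->
  [/\ (hypergraph_code H)`_(3 * e + 2) = x%:R, (hypergraph_code H)`_(3 * e + 3) = y%:R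
    & (hypergraph_code H)`_(3 * e + 4) = z%:R].
Proof.
move=> eH en; have es : (e < size rows)%N by rewrite size_map -cardE.
have h k : (k < 3)%N -> (hypergraph_code H)`_(3 * e + k.+2) = [:: x%:R; y%:R; z%:R]`_k.
  move=> k3; rewrite !addnS /= (nth_flatten_const 0 rows3) //.
  by rewrite (nth_map finset.set0) -?cardE // en.
by split; [exact: (h 0%N) | exact: (h 1%N) | exact: (h 2)].
Qed.

End Code.

(** The analogue of [hoare] for plain memories, needed for the commands that run
    before cell 0 holds the base address. *)
Definition cmdto L c m r m' r' :=
  mbnd L m -> exists t, [/\ exec c m r t m' r', (t <= cost_bound c L)%N & mbnd L m'].

Lemma cmdto_seq L c1 c2 m r m1 r1 m2 r2 :
  cmdto L c1 m r m1 r1 -> cmdto L c2 m1 r1 m2 r2 -> cmdto L (Seq c1 c2) m r m2 r2.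
Proof.
move=> h1 h2 /h1 [t1 [e1 l1 /h2 [t2 [e2 l2 b2]]]].
exists (1 + t1 + t2)%N; split=> //; first exact: exec_seq e1 e2.
by rewrite /= !leq_add.
Qed.

Lemma cmdto_write L a e m r (x y : rat) : (0 < L)%N -> eval m a = x -> eval m e = y ->
  bnd L y -> cmdto L (Write a e) m r (upd m x y) r.
Proof.
move=> L0 <- <- bv bm; exists (1 + ecost m a + ecost m e)%N; split.
- exact: exec_write.
- by apply: leq_add (ecost_le L0 bm _); rewrite leq_add2l (ecost_le L0 bm).
- exact: mbnd_upd.
Qed.

Definition blank (code : seq rat) : store := fun a k => if eqn a LOW then code`_k else 0.

Lemma lay_blank b (code : seq rat) : (0 < b)%N -> (size code <= b)%N ->
  upd (input code) 0 b%:R = lay b (blank code).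
Proof.
move=> b0 sb; apply/funext => i; rewrite /upd (natrK 0) /lay /input /blank.
case: eqP => // _; case: ltnP => // bi.
have -> : eqn ((i - b) %% 32) 32 = false.
  by apply/negbTE/negP => /eqnP e; have := ltn_pmod (i - b) (isT : (0 < 32)%N); rewrite e.
by rewrite nth_default // (leq_trans sb).
Qed.

Lemma upd0C m (a : nat) x y : (0 < a)%N ->
  upd (upd m 0 y) a%:R x = upd (upd m a%:R x) 0 y.
Proof.
move=> a0; apply/funext => i; rewrite /upd natrK (natrK 0).
by case: (eqVneq i 0%N) => // ->; rewrite eq_sym -[a == 0%N]negbK -lt0n a0.
Qed.

(** An address beyond the input and beyond the cells of the output. *)
Definition base_solve :=
  EAdd (EAdd (Read (Cst 0)) (EMul (Cst 3) (Read (Cst 1)))) (Cst 2).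

Definition pre_solve :=
  Seq (Write (EAdd base_solve (Cst 1)) (Read (Cst 0)))
  (Seq (Write (EAdd base_solve (Cst 2)) (Read (Cst 1)))
       (Write (Cst 0) base_solve)).

Lemma eval_base_solve m n k : m 0%N = n%:R -> m 1%N = k%:R ->
  eval m base_solve = (n + 3 * k + 2)%N%:R.
Proof.
move=> h0 h1; rewrite /base_solve !evE.
have -> : eval m (Read (Cst 0)) = n%:R by rewrite -h0 /= (natrK 0).
have -> : eval m (Read (Cst 1)) = k%:R by rewrite -h1 /= (natrK 1).
by rewrite (natrD _ (n + 3 * k)%N) (natrD _ n) (natrM _ 3).
Qed.

Lemma pre_solve_ok n k (code : seq rat) L r (b := (n + 3 * k + 2)%N) :
  (0 < L)%N -> (b <= 2 ^ L)%N -> code`_0 = n%:R -> code`_1 = k%:R -> (size code <= b)%N ->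
  cmdto L pre_solve (input code) r
    (lay b (supd (supd (blank code) aN 0 n%:R) aM 0 k%:R)) r.
Proof.
move=> L0 bL c0 c1 sb; have b0 : (0 < b)%N by rewrite /b addn2.
have bn : bnd L n%:R by apply: bnd_natr; apply: leq_trans bL; rewrite /b; lia.
have bk : bnd L k%:R by apply: bnd_natr; apply: leq_trans bL; rewrite /b; lia.
rewrite -!lay_supd // -lay_blank // !muln0 !addn0.
have bi i : (0 < b + i)%N by apply: leq_trans b0 (leq_addr _ _).
rewrite !upd0C ?bi //.
have rd0 (m : mem) : eval m (Read (Cst 0)) = m 0%N by rewrite /= (natrK 0).
have rd1 (m : mem) : eval m (Read (Cst 1)) = m 1%N by rewrite /= (natrK 1).
have up (m : mem) (a : nat) x i : (i < 2)%N -> (2 <= a)%N -> upd m a%:R x i = m i.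
  by move=> i2 a2; rewrite /upd natrK; case: eqP => // e; rewrite e ltnNge a2 in i2.
have bb i : (0 < i)%N -> (2 <= b + i)%N by rewrite /b; lia.
have bb1 := bb 1%N isT; have bb2 := bb 2 isT.
set m1 := upd (input code) _ _; set m2 := upd m1 _ _.
have m10 : m1 0%N = n%:R by rewrite /m1 up.
have m11 : m1 1%N = k%:R by rewrite /m1 up.
have m20 : m2 0%N = n%:R by rewrite /m2 up.
have m21 : m2 1%N = k%:R by rewrite /m2 up.
apply: (cmdto_seq (m1 := m1) (r1 := r)).
  apply: (cmdto_write _ L0 _ _ bn); last by rewrite rd0.
  by rewrite evalD (eval_base_solve (n := n) (k := k)) // evalC -natrD.
apply: (cmdto_seq (m1 := m2) (r1 := r)).
  apply: (cmdto_write _ L0 _ _ bk); last by rewrite rd1.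
  by rewrite evalD (eval_base_solve (n := n) (k := k)) // evalC -natrD.
by apply: (cmdto_write _ L0 _ (eval_base_solve m20 m21)) => //; exact: bnd_natr.
Qed.

Definition base_round := EAdd (Read (Cst 0)) (Cst 1).

Definition pre_round :=
  Seq (Write (EAdd base_round (Cst 1)) (Read (Cst 0))) (Write (Cst 0) base_round).

Lemma pre_round_ok n (code : seq rat) L r (b := n.+1) :
  (0 < L)%N -> (b <= 2 ^ L)%N -> code`_0 = n%:R -> (size code <= b)%N ->
  cmdto L pre_round (input code) r (lay b (supd (blank code) aN 0 n%:R)) r.
Proof.
move=> L0 bL c0 sb; have b0 : (0 < b)%N by [].
have bn : bnd L n%:R by apply: bnd_natr; apply: leq_trans bL; rewrite /b; lia.
rewrite -!lay_supd // -lay_blank // !muln0 !addn0.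
rewrite upd0C //.
have rd0 (m : mem) : eval m (Read (Cst 0)) = m 0%N by rewrite /= (natrK 0).
have up : upd (input code) (b + 1)%N%:R n%:R 0%N = n%:R by rewrite /upd natrK addn1.
apply: (cmdto_seq (r1 := r)).
  apply: (cmdto_write _ L0 _ _ bn); last by rewrite rd0.
  by rewrite /base_round !evE rd0 /input c0 -!natrD addn1.
apply: (cmdto_write _ L0 _ _ (bnd_natr bL)) => //.
by rewrite /base_round !evE rd0 up -natrD addn1.
Qed.

Definition solve_prog :=
  Seq (Seq pre_solve elim_prog) (Seq comb_prog output_prog).

Definition rounding_prog := Seq pre_round round_prog.

(** Exceeds the base address and the numbers of rounds, as well as the bit length
    of n 2^n n!, which bounds the entries of the random combination. *)
Definition Lsize (s : nat) : nat := (s * s + 10 * s + 10)%N.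

Lemma code_bnd n (H : hypergraph 'I_n) L : uniform3 H -> (n <= L)%N -> (#|H| <= L)%N ->
  mbnd L (input (hypergraph_code H)).
Proof.
move=> H3 nL mL; have nat_b k : (k <= L)%N -> bnd L k%:R.
  by move=> kL; apply: bnd_natr; apply: leq_trans (leq_expn2 _) (leq_pow2 kL).
case=> [|[|i]] /=; [exact: nat_b | exact: nat_b |].
rewrite /input /=; set row := flatten _; case: (ltnP i (size row)) => h.
  have /flatten_mapP [e _ /mapP[x _ ->]] := mem_nth 0 h.
  by apply: nat_b; apply: leq_trans nL; apply: ltnW.
by rewrite nth_default //; exact: bnd0.
Qed.

Lemma solve_ok n (H : hypergraph 'I_n) (L := Lsize (n + #|H|)) : uniform3 H ->
  exists C E, reduced (edges H) C E /\
  forall r, (n * n <= size r)%N -> exists t m' r',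
    [/\ exec solve_prog (input (hypergraph_code H)) r t m' r',
        (t <= cost_bound solve_prog L)%N, mbnd L m' &
        forall x : 'I_n, m' x.+1 = comb (C x) r].
Proof.
move=> H3; set k := #|H|; pose b := (n + 3 * k + 2)%N.
have L0 : (0 < L)%N by rewrite /L /Lsize; lia.
have b0 : (0 < b)%N by rewrite /b; lia.
have bL : (b <= 2 ^ L)%N by apply: leq_trans (leq_expn2 _); rewrite /L /Lsize /b; lia.
have nL : (n * n + 2 * n + 2 <= L)%N by rewrite /L /Lsize; nia.
have inb : mbnd L (input (hypergraph_code H)).
  by apply: code_bnd; rewrite // /L /Lsize -/k; lia.
set code := hypergraph_code H in inb *.
pose s0 := supd (supd (blank code) aN 0 n%:R) aM 0 k%:R.
(* The elimination is run on the empty tape: [C] must not depend on the coins. *)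
have pre r : cmdto L pre_solve (input code) r (lay b s0) r.
  by apply: pre_solve_ok => //; rewrite size_code // -/k; lia.
have [t0 [e0 l0 bs0]] := pre [::] inb.
have el : hoare b L elim_prog s0 [::] (fun s' r' =>
    [/\ r' = [::], agree [:: aE; aC; aG; aT; aP; aFound; aCol; aLead; cI; cJ; cK] s0 s' &
     exists C E, holds s' C E /\ reduced (edges H) C E]).
  apply: elim_spec => //.
  - by rewrite -/k /L /Lsize; lia.
  - by rewrite -/k /b; lia.
  - by move=> e x y z; exact: nth_code.
have [t1 [s1 [r1 [e1 l1 bs1 [r1E ag [C [E [hS red]]]]]]]] := el bs0.
exists C, E; split=> // r nr.
have h14 q : s1 aSol q = 0 by rewrite (ag aSol _ isT).
have [t2 [s2 [r2 [e2 l2 bs2 hs2]]]] :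
    exists t s' r', [/\ exec comb_prog (lay b s1) r t (lay b s') r', (t <= cost_bound comb_prog L)%N,
      mbnd L (lay b s') & s' aN 0%N = n%:R /\ forall x : 'I_n, s' aSol x = comb (C x) r].
  exact: (comb_spec b0 nL hS red h14 nr bs1).
have [hn2 hv2] := hs2.
have b14 q : bnd L (s2 aSol q) by rewrite -(@lay_hi b) //; apply: bs2.
have nb : (n < b)%N by rewrite /b; lia.
have [t3 [s3 [r3 [e3 l3 bs3 hs3]]]] := output_spec b0 nL r2 nb hn2 hv2 b14 bs2.
exists (1 + (1 + t0 + t1) + (1 + t2 + t3))%N, (lay b s3), r3; split=> //.
- rewrite r1E in e1; apply: exec_seq (exec_seq e2 e3).
  exact: exec_seq (exec_cat r e0) (exec_cat r e1).
- by rewrite /= !leq_add.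
- move=> x; rewrite -hs3 /lay /=; case: ifP => // /negbT; rewrite -leqNgt => h.
  by have := ltn_ord x; lia.
Qed.

Lemma round_ok n (v : 'cV[rat]_n) L r : (0 < L)%N -> (n < L)%N ->
  (forall x, v x 0 \is a Num.int) -> (forall x, bnd L (v x 0)) ->
  exists t m' r',
    [/\ exec rounding_prog (input (vector_code v)) r t m' r',
        (t <= cost_bound rounding_prog L)%N &
        forall x : 'I_n, capped_val n (v x 0) (m' x.+1)].
Proof.
move=> L0 nL iv bv.
have b0 : (0 < n.+1)%N by [].
have bL : (n.+1 <= 2 ^ L)%N by apply: leq_trans (leq_expn2 _) (leq_pow2 _).
set code := vector_code v.
have sc : size code = n.+1 by rewrite /= size_map size_enum_ord.
have nc (x : 'I_n) : code`_x.+1 = v x 0.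
  by rewrite /= (nth_map x) ?size_enum_ord // nth_ord_enum.
have inb : mbnd L (input code).
  case=> [|i]; first by apply: bnd_natr; apply: ltnW.
  case: (ltnP i n) => h; first by rewrite /input (nc (Ordinal h)).
  by rewrite /input nth_default ?sc //; exact: bnd0.
pose s0 := supd (blank code) aN 0 n%:R.
have [||t0 [e0 l0 bs0]] := @pre_round_ok n code L r L0 bL _ _ inb; rewrite ?sc //.
have hv (x : 'I_n) : s0 LOW x.+1 = v x 0 by rewrite -nc.
have [t1 [s1 [r1 [e1 l1 bs1 hs1]]]] :=
  @round_spec n L n.+1 (fun x => v x 0) s0 r L0 (ltnW nL) (ltnSn n) erefl hv iv bv bs0.
exists (1 + t0 + t1)%N, (lay n.+1 s1), r1; split=> //.
- exact: exec_seq e0 e1.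
- by rewrite /= !leq_add.
- by move=> x; have := hs1 x; rewrite /lay /= ltnS ltn_ord.
Qed.

Lemma log_bounds n (k := (trunc_log 2 n + 3)%N) : (8 <= n)%N ->
  (k <= n)%N /\ (4 * n < 2 ^ k)%N.
Proof.
move=> n8; have n0 : (0 < n)%N by apply: leq_trans n8.
have t3 : (3 <= trunc_log 2 n)%N by apply: trunc_log_max.
have h i : (i + 6 <= 2 ^ (i + 3))%N.
  by elim: i => [//|i ih]; rewrite !addSn expnS; lia.
split.
  apply: leq_trans (trunc_logP (isT : 1 < 2)%N n0).
  by have := h (trunc_log 2 n - 3)%N; rewrite subnK // /k; lia.
have := trunc_log_ltn n (isT : (1 < 2)%N).
by rewrite /k addn3 !expnS; lia.
Qed.

Lemma quarter_le (a b : nat) : (0 < b)%N -> (b <= 2 * a)%N ->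
  1 / 4 <= a%:R / b%:R :> rat.
Proof.
move=> b0 h; rewrite ler_pdivlMr ?ltr0n //.
have : (b%:R : rat) <= (2 * a)%N%:R by rewrite ler_nat.
by rewrite natrM; have : (0 : rat) <= b%:R by []; lra.
Qed.

Theorem theorem8 (R : realType) :
  exists (solve rounding : cmd) (p : {poly nat}) (C : R),
    (forall (n : nat) (H : hypergraph 'I_n), uniform3 H ->
       forall r : (p.[(n + #|H|)%N]).-tuple bool,
       exists (t : nat) (v w : 'cV[rat]_n),
         run solve rounding H r t v w /\ (t <= p.[(n + #|H|)%N])%N) /\
    (forall (n : nat) (H : hypergraph 'I_n), (8 <= n)%N -> uniform3 H ->
       (exists c : 'I_n -> 'I_2, LO_colouring H c) ->
       1 / 4 <= Pr (fun r : (p.[(n + #|H|)%N]).-tuple bool =>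
         exists (t : nat) (v w : 'cV[rat]_n) (k : nat) (c : 'I_n -> 'I_k),
           [/\ run solve rounding H r t v w,
               incidence H *m v = 0,
               (forall i, w i 0 = (nat_of_ord (c i))%:R),
               LO_colouring H c
             & k%:R <= 3 / 2 * log2 (n%:R : R) + C * log2 (log2 (n%:R : R))])).
Proof.
have [ps hps] := cost_bound_poly solve_prog; have [pr hpr] := cost_bound_poly rounding_prog.
pose Lp : {poly nat} := 'X * 'X + 10%N%:P * 'X + 10%N%:P.
(* [p] is also the length of the tape, of which n ^ 2 coins are read. *)
pose p := (ps \Po Lp) + (pr \Po Lp) + 'X * 'X.
have pE s : p.[s] = (cost_bound solve_prog (Lsize s) + cost_bound rounding_prog (Lsize s) + s * s)%N.
  have LE : Lp.[s] = Lsize s by rewrite /Lp !(hornerC, hornerX, hornerM, hornerD).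
  by rewrite /p !(hornerX, hornerM, hornerD) !horner_comp LE -hps -hpr.
have full n (H : hypergraph 'I_n) : uniform3 H -> exists C E, reduced (edges H) C E /\
    forall r : (p.[(n + #|H|)%N]).-tuple bool, exists t w,
      [/\ run solve_prog rounding_prog H r t (\col_x comb (C x) r) w,
          (t <= p.[(n + #|H|)%N])%N &
          forall x, capped_val n (comb (C x) r) (w x 0)].
  move=> H3; have [C [E [red hrun]]] := solve_ok H3; exists C, E; split=> // r.
  have nr : (n * n <= size r)%N by rewrite size_tuple pE; nia.
  have [t1 [m1 [r1 [e1 l1 b1 hv]]]] := hrun r nr.
  have vE : \col_x comb (C x) r = output n m1.
    by apply/colP => x; rewrite !mxE hv.
  have L0 : (0 < Lsize (n + #|H|))%N by rewrite /Lsize; lia.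
  have nL : (n < Lsize (n + #|H|))%N by rewrite /Lsize; lia.
  have iv x : (\col_x comb (C x) r) x 0 \is a Num.int.
    rewrite mxE; apply: rpred_sum => i _; apply: rpredM; last exact: (red_int red).
    exact: coefp_int.
  have bv x : bnd (Lsize (n + #|H|)) ((\col_x comb (C x) r) x 0).
    by rewrite vE mxE; apply: b1.
  have [t2 [m2 [r2 [e2 l2 hw]]]] := @round_ok n _ _ r1 L0 nL iv bv.
  exists (t1 + t2)%N, (output n m2); split.
  - exists t1, m1, r1, t2, m2, r2; split=> //.
  - by rewrite pE; lia.
  - by move=> x; have := hw x; rewrite !mxE.
exists solve_prog, rounding_prog, p, 3; split.
  move=> n H /full [C [E [_ h]]] r; have [t [w [h1 h2 _]]] := h r.
  by exists t, (\col_x comb (C x) r), w.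
move=> n H n8 H3 [c2 lo]; have [C [E [red h]]] := full n H H3.
set N := p.[(n + #|H|)%N] in h *.
pose k := (trunc_log 2 n + 3)%N; have [kn k4] := log_bounds n8.
have nN : (n * n <= N)%N by rewrite /N pE; nia.
have := union_tail nN (red_int red) (fun x => LO2_row x H3 lo red) kn k4.
set G := [set r | _] => hG.
have sub : G \subset [set r : N.-tuple bool | `[< exists (t : nat) (v w : 'cV[rat]_n) (k : nat) (c : 'I_n -> 'I_k),
           [/\ run solve_prog rounding_prog H r t v w,
               incidence H *m v = 0,
               (forall i, w i 0 = (nat_of_ord (c i))%:R),
               LO_colouring H c
             & k%:R <= 3 / 2 * log2 (n%:R : R) + 3 * log2 (log2 (n%:R : R))] >]].
  apply/fintype.subsetP => r; rewrite !inE => /forallP good; do 2!apply/asboolP.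
  have [t [w [hr _ hw]]] := h r.
  have ex x : exists cy : 'I_k * rat, [/\ w x 0 = (nat_of_ord cy.1)%:R,
      comb (C x) r = cy.2 * 2 ^+ cy.1 & oddq cy.2].
    have [c [y [wc vy iy cn oy]]] := hw x.
    have ck : (c < k)%N.
      rewrite ltnNge; apply: contra (good x) => kc.
      by rewrite vy -(subnK kc) exprD mulrA mulfK ?expf_neq0 // rpredM // rpredX // (rpred_nat _ 2).
    exists (Ordinal ck, y); split=> //=.
    by case: oy => // cn'; move: ck; rewrite cn' ltnNge kn.
  have [cy hcy] := choice ex.
  have ker e : e \in H -> edge_row e *m (\col_x comb (C x) r) = 0.
    move=> eH; have -> : \col_x comb (C x) r = C *m \col_j coef n r j.
      by apply/colP => x; rewrite !mxE; apply: eq_bigr => j _; rewrite mxE mulrC.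
    by rewrite mulmxA (red_ker red) ?mul0mx //; exists e.
  exists t, (\col_x comb (C x) r), w, k, (fun x => (cy x).1); split=> //.
  - exact: incidence_ker.
  - by move=> x; have [] := hcy x.
  - apply: (LO_val (y := fun x => (cy x).2) H3 ker) => x.
    by have [_ h1 h2] := hcy x; rewrite mxE.
  - exact: colours_le.
have := subset_leq_card sub; set P := (X in (_ <= X)%N); rewrite /Pr -/P => GP.
apply: quarter_le; first by rewrite expn_gt0.
by apply: leq_trans hG _; rewrite leq_mul2l GP orbT.
Qed.
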